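(* Let $X=\mathbb{C}$ or $X=\mathbb{CP}^1$ and let $n>4$. Any non-cyclic endomorphism $\varphi$ of the group $B_n(X)$ respects the normal subgroup $PB_n(X)$, i.e. $\varphi(PB_n(X))\subseteq PB_n(X)$. In fact, $PB_n(X)=\varphi^{-1}(PB_n(X))$.
   Context: For $X=\mathbb{C}$ or $X=\mathbb{CP}^1$, let $\mathcal{C}_o^n(X)=\{(q_1,\dots,q_n)\in X^n: q_i\neq q_j\ \forall i\ne j\}$ and $\mathcal{C}^n(X)=\mathcal{C}_o^n(X)/\mathbf{S}(n)$ (the space of $n$-point subsets of $X$). $B_n(X)=\pi_1(\mathcal{C}^n(X))$ is the braid group and $PB_n(X)=\pi_1(\mathcal{C}_o^n(X))$ the pure braid group, regarded as a normal subgroup of $B_n(X)$ via the covering $\mathcal{C}_o^n(X)\to\mathcal{C}^n(X)$. Thus $B_n(\mathbb{C})=B_n$ is the Artin braid group with generators $\sigma_1,\dots,\sigma_{n-1}$ and relations $\sigma_i\sigma_j=\sigma_j\sigma_i$ ($|i-j|\ge2$), $\sigma_i\sigma_{i+1}\sigma_i=\sigma_{i+1}\sigma_i\sigma_{i+1}$; $B_n(\mathbb{CP}^1)=B_n(S^2)$ is the sphere braid group, obtained by adding the relation $\sigma_1\cdots\sigma_{n-1}\sigma_{n-1}\cdots\sigma_1=1$. In both cases $PB_n(X)$ is the kernel of the standard epimorphism $\mu\colon B_n(X)\to\mathbf{S}(n)$, $\sigma_i\mapsto(i,i+1)$. A group homomorphism is cyclic if its image is a cyclic group, and non-cyclic otherwise.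 *)

(* Defs.v *)
From HB Require Import structures.
From mathcomp Require Import all_boot all_fingroup.
From mathcomp Require Import boolp classical_sets.
From mathcomp Require Import generic_quotient.

Set Implicit Arguments.
Unset Strict Implicit.
Unset Printing Implicit Defensive.

Local Open Scope group_scope.
Local Open Scope quotient_scope.
Local Open Scope classical_set_scope.

(* Group presentations. The letter (i, false) stands for the generator i and
   (i, true) for its inverse. A relation R u v reads "u = v". *)

Section Presentation.
Variables (I : choiceType) (R : seq (I * bool) -> seq (I * bool) -> Prop).
Local Notation word := (seq (I * bool)).

Inductive pres_eq : word -> word -> Prop :=
| pres_refl u : pres_eq u u
| pres_sym u v : pres_eq u v -> pres_eq v u
| pres_trans u v w : pres_eq u v -> pres_eq v w -> pres_eq u w
| pres_cat u u' v v' : pres_eq u u' -> pres_eq v v' ->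
    pres_eq (u ++ v) (u' ++ v')
| pres_cancel i b : pres_eq [:: (i, b); (i, ~~ b)] [::]
| pres_rel u v : R u v -> pres_eq u v.

Definition pres_eqb : rel word := fun u v => `[< pres_eq u v >].

Lemma pres_eqb_refl : reflexive pres_eqb.
Proof. by move=> u; apply/asboolP; apply: pres_refl. Qed.

Lemma pres_eqb_sym : symmetric pres_eqb.
Proof. by move=> u v; apply/asboolP/asboolP; apply: pres_sym. Qed.

Lemma pres_eqb_trans : transitive pres_eqb.
Proof.
move=> v u w /asboolP uv /asboolP vw; apply/asboolP.
exact: pres_trans uv vw.
Qed.

Canonical pres_equiv :=
  EquivRel pres_eqb pres_eqb_refl pres_eqb_sym pres_eqb_trans.

Definition presented : Type := {eq_quot pres_equiv}.
HB.instance Definition _ := Choice.on presented.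
HB.instance Definition _ := EqQuotient.on presented.

Lemma pres_piP u v : \pi_presented u = \pi_presented v <-> pres_eq u v.
Proof.
split; first by move/eqmodP/asboolP.
by move=> uv; apply/eqmodP/asboolP.
Qed.

Lemma pres_repr u : pres_eq (repr (\pi_presented u)) u.
Proof. by apply/pres_piP; rewrite reprK. Qed.

Definition word_inv (u : word) : word := rev [seq (l.1, ~~ l.2) | l <- u].

Lemma word_invK : involutive word_inv.
Proof.
move=> u; rewrite /word_inv map_rev revK -map_comp map_id_in //.
by move=> [i b] _ /=; rewrite negbK.
Qed.

Lemma word_invr u : pres_eq (u ++ word_inv u) [::].
Proof.
elim: u => [|[i b] u IHu]; first exact: pres_refl.
rewrite /word_inv /= rev_cons -cats1 catA -/(word_inv u).
rewrite -[(i, b) :: _]/([:: (i, b)] ++ (u ++ word_inv u) ++ [:: (i, ~~ b)]).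
apply: pres_trans (pres_cancel i b).
apply: (pres_cat (pres_refl [:: (i, b)])).
exact: (pres_cat IHu (pres_refl [:: (i, ~~ b)])).
Qed.

Lemma word_invl u : pres_eq (word_inv u ++ u) [::].
Proof. by have := word_invr (word_inv u); rewrite word_invK. Qed.

Lemma word_inv_eq u v : pres_eq u v -> pres_eq (word_inv u) (word_inv v).
Proof.
move=> uv; apply: (@pres_trans _ (word_inv u ++ (v ++ word_inv v))).
  rewrite -[X in pres_eq X]cats0; apply: pres_cat; first exact: pres_refl.
  exact/pres_sym/word_invr.
rewrite catA -[X in pres_eq _ X]cat0s; apply: pres_cat; last exact: pres_refl.
apply: pres_trans (word_invl u); apply: pres_cat; first exact: pres_refl.
exact: pres_sym.
Qed.

Definition pres_one : presented := \pi_presented [::].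
Definition pres_mul (x y : presented) : presented :=
  \pi_presented (repr x ++ repr y).
Definition pres_inv (x : presented) : presented :=
  \pi_presented (word_inv (repr x)).

Lemma pres_mulE u v :
  pres_mul (\pi_presented u) (\pi_presented v) = \pi_presented (u ++ v).
Proof. by apply/pres_piP; apply: pres_cat; apply: pres_repr. Qed.

Lemma pres_invE u : pres_inv (\pi_presented u) = \pi_presented (word_inv u).
Proof. by apply/pres_piP; apply: word_inv_eq; apply: pres_repr. Qed.

Lemma pres_mulA : associative pres_mul.
Proof.
move=> x y z; rewrite -[x]reprK -[y]reprK -[z]reprK.
by rewrite !(pres_mulE (repr _) (repr _)) !pres_mulE catA.
Qed.

Lemma pres_mul1 : left_id pres_one pres_mul.
Proof. by move=> x; rewrite -[x]reprK pres_mulE. Qed.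

Lemma pres_mulr1 : right_id pres_one pres_mul.
Proof. by move=> x; rewrite -[x]reprK pres_mulE cats0. Qed.

Lemma pres_mulV : left_inverse pres_one pres_inv pres_mul.
Proof.
move=> x; rewrite -[x]reprK pres_invE pres_mulE; apply/pres_piP.
exact: word_invl.
Qed.

Lemma pres_mulrV : right_inverse pres_one pres_inv pres_mul.
Proof.
move=> x; rewrite -[x]reprK pres_invE pres_mulE; apply/pres_piP.
exact: word_invr.
Qed.

HB.instance Definition _ := isGroup.Build presented
  pres_mulA pres_mul1 pres_mulr1 pres_mulV pres_mulrV.

Definition pres_gen (i : I) : presented := \pi_presented [:: (i, false)].

Lemma pres_prod_gen u : \pi_presented u =
  \prod_(l <- u) (if l.2 then (pres_gen l.1)^-1 else pres_gen l.1).
Proof.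
elim: u => [|[i b] u IHu]; first by rewrite big_nil.
rewrite big_cons -IHu -cat1s -pres_mulE /=; congr (_ * _).
by case: b => //; rewrite -[RHS]/(pres_inv _) pres_invE.
Qed.

Variables (G : groupType) (f : I -> G).

Definition word_eval (u : word) : G :=
  \prod_(l <- u) (if l.2 then (f l.1)^-1 else f l.1).

(* This is the homomorphism i |-> f i as soon as f satisfies the relations
   (pres_liftE, pres_liftM), and is not meant to be used otherwise. *)
Definition pres_lift (x : presented) : G := word_eval (repr x).

Hypothesis f_rel : forall u v, R u v -> word_eval u = word_eval v.

Lemma word_eval_eq u v : pres_eq u v -> word_eval u = word_eval v.
Proof.
elim=> [//|{}u {}v _ //|{}u {}v w _ -> _ //|{}u u' {}v v' _ Eu _ Ev|i b|//].
  by rewrite /word_eval !big_cat /= -!/(word_eval _) Eu Ev.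
rewrite /word_eval !big_cons big_nil /= mulg1.
by case: b; rewrite /= ?mulVg ?mulgV.
Qed.

Lemma pres_liftE u : pres_lift (\pi_presented u) = word_eval u.
Proof. exact/word_eval_eq/pres_repr. Qed.

Lemma pres_lift_gen i : pres_lift (pres_gen i) = f i.
Proof. by rewrite pres_liftE /word_eval big_seq1. Qed.

Lemma pres_liftM : {morph pres_lift : x y / x * y}.
Proof.
move=> x y; rewrite -[x]reprK -[y]reprK.
rewrite -[X in pres_lift X]/(pres_mul _ _) pres_mulE !pres_liftE.
by rewrite /word_eval big_cat.
Qed.

End Presentation.

(* The fundamental group of the space of n-point subsets of C or CP^1 is
   represented by its Artin presentation, and that of the space of ordered
   configurations by the kernel of the permutation map. *)
Inductive surface := Cplane | CP1.

Section Braids.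
Variables (X : surface) (n : nat).

(* The index i : 'I_n.-1 is 0-based: it stands for sigma_(i+1). *)
Local Notation sg i := (i, false).

Inductive braid_rel : seq ('I_n.-1 * bool) -> seq ('I_n.-1 * bool) -> Prop :=
| braid_rel_far (i j : 'I_n.-1) : i.+1 < j ->
    braid_rel [:: sg i; sg j] [:: sg j; sg i]
| braid_rel_adj (i j : 'I_n.-1) : j = i.+1 :> nat ->
    braid_rel [:: sg i; sg j; sg i] [:: sg j; sg i; sg j]
| braid_rel_sphere : X = CP1 ->
    braid_rel [seq sg i | i <- enum 'I_n.-1 ++ rev (enum 'I_n.-1)] [::].

Definition braid_group : Type := presented braid_rel.
HB.instance Definition _ := Group.on braid_group.
HB.instance Definition _ := EqQuotient.on braid_group.

Definition sigma (i : 'I_n.-1) : braid_group := pres_gen braid_rel i.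

Lemma strand_lo (i : 'I_n.-1) : i < n.
Proof. exact: leq_trans (ltn_ord i) (leq_pred n). Qed.

Lemma strand_hi (i : 'I_n.-1) : i.+1 < n.
Proof. by rewrite -ltn_predRL. Qed.

Definition adj_tperm (i : 'I_n.-1) : 'S_n :=
  tperm (Ordinal (strand_lo i)) (Ordinal (strand_hi i)).

Definition braid_perm : braid_group -> 'S_n := pres_lift adj_tperm.

Lemma adj_tpermK i : adj_tperm i * adj_tperm i = 1.
Proof. exact: tperm2. Qed.

Lemma adj_tperm_rel u v : braid_rel u v ->
  word_eval adj_tperm u = word_eval adj_tperm v.
Proof.
rewrite /word_eval; case=> [i j ij|i j ij|_].
- rewrite !big_cons !big_nil /= !mulg1.
  apply/commgP/conjg_fixP; rewrite /adj_tperm tpermJ.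
  have ij' : i < j by apply: ltnW.
  by rewrite !tpermD // -val_eqE /= gtn_eqF // leqW.
- rewrite !big_cons !big_nil /= !mulg1.
  have eqt : Ordinal (strand_lo j) = Ordinal (strand_hi i) by apply: val_inj.
  have lo_hi : Ordinal (strand_lo i) != Ordinal (strand_hi i).
    by rewrite -val_eqE /= ltn_eqF.
  have hi_hi : Ordinal (strand_hi i) != Ordinal (strand_hi j).
    by rewrite -val_eqE /= ltn_eqF // -ij.
  have lo_hij : Ordinal (strand_lo i) != Ordinal (strand_hi j).
    by rewrite -val_eqE /= ltn_eqF // ij ltnW.
  have E1 : adj_tperm j ^ adj_tperm i = adj_tperm i ^ adj_tperm j.
    rewrite /adj_tperm !tpermJ eqt tpermL tpermR.
    by rewrite !tpermD // eq_sym.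
  by move: E1; rewrite !conjgE /adj_tperm !tpermV.
rewrite big_map big_cat /= big_nil.
elim: (enum _) => [|i s IHs]; first by rewrite !big_nil mulg1.
rewrite rev_cons -cats1 big_cat /= big_seq1 big_cons mulgA -[X in X * _]mulgA.
by rewrite IHs mulg1 adj_tpermK.
Qed.

Lemma braid_perm_sigma i : braid_perm (sigma i) = adj_tperm i.
Proof. exact: pres_lift_gen adj_tperm_rel i. Qed.

Lemma braid_permM : {morph braid_perm : x y / x * y}.
Proof. exact: pres_liftM adj_tperm_rel. Qed.

HB.instance Definition _ :=
  isMultiplicative.Build braid_group 'S_n braid_perm braid_permM.

Definition pure_braids : set braid_group := [set b | braid_perm b = 1].

End Braids.

Arguments sigma X {n} i.
Arguments pure_braids X n : clear implicits.

Definition cyclic_hom (G H : groupType) (phi : G -> H) : Prop :=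
  exists h : H, range phi = [set x | exists k : nat, x = h ^+ k \/ x = h ^- k].

(* Main.v *)
(* Let u_i be the permutation of phi(sigma_i).

   If all u_i coincide, then phi maps the commutator subgroup into the pure
   braids. For n > 4 the commutator subgroup is perfect, and pure braid groups
   have no perfect subgroups other than 1: combing embeds a plane pure braid
   group into the semidirect product of a free group and a smaller pure braid
   group, free groups are residually nilpotent by Magnus' unitriangular
   matrices, and the stabilizer of a strand in the sphere braid group is a
   central quotient of a plane braid group. Hence phi is cyclic.

   Otherwise we follow Kolay. The n(n-1)/2 half twists have distinct images, so
   the conjugacy class of u_1 in G = <u_1, ..., u_(n-1)> has at least n(n-1)/2
   elements. The centralizer of u_1 contains J = <u_1, u_3, ..., u_(n-1)>, and
   modulo its centre, which contains u_1, the group J is a non-cyclic image of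
   the braid group on n-2 strands, hence of order at least (n-2)! by induction.
   As |G| <= n!, the order of u_1 is 2, so sigma_i |-> u_i factors through the
   symmetric group. Its kernel is normal and does not contain A_n, so it is the
   pure braid group. The case n = 6 needs an extra argument because
   the braid group on four strands maps onto the symmetric group of degree 3. *)
Require Import Defs.
From HB Require Import structures.
From mathcomp Require Import all_boot all_algebra all_fingroup all_solvable.
From mathcomp Require Import boolp classical_sets.
From mathcomp Require Import generic_quotient zify ring.
From mathcomp Require Import fintype finset.

Set Implicit Arguments.
Unset Strict Implicit.
Unset Printing Implicit Defensive.

Local Open Scope group_scope.
Local Open Scope quotient_scope.

(** The property carried along the combing is the absence of nontrivial perfect subgroups rather
    than residual nilpotence, because it passes to extensions without any condition on the action: a
    perfect subgroup dies in the quotient, hence lies in the kernel, and dies there. It also passes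
    to central quotients, as the sphere requires.

    Braid groups are given by generators and relations, so the fibration that forgets the last
    strand is replaced by rewriting. The braids that bring the last strand back form a subgroup with
    one coset representative for each position of that strand, and a generator applied to a
    representative gives an element of the subgroup followed by another representative. This rule
    acts on pairs of an element and a position; once the relations are checked on pairs, a pure
    braid is sent to the element that it leads to. In the plane the elements are taken in an
    abstract semidirect product, so its free factor is free by construction, and evaluating the
    pairs in the braid group shows that nothing is lost. *)

(** * Perfect subgroups and their images *)

Definition is_subgroup (G : groupType) (P : G -> Prop) :=
  [/\ P 1, forall x y, P x -> P y -> P (x * y) & forall x, P x -> P x^-1].

(* The second clause says that [P] is generated by its commutators. *)
Definition is_perfect (G : groupType) (P : G -> Prop) :=
  is_subgroup P /\ forall Q : G -> Prop, is_subgroup Q ->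
    (forall a b, P a -> P b -> Q [~ a, b]) -> forall x, P x -> Q x.

Definition no_perfect (G : groupType) (K : G -> Prop) :=
  forall P : G -> Prop, is_perfect P -> (forall x, P x -> K x) ->
    forall x, P x -> x = 1.

Lemma is_subgroup1 (G : groupType) : is_subgroup (fun x : G => x = 1).
Proof.
by split=> // [x y -> ->|x ->]; rewrite ?mulg1 ?invg1.
Qed.

Lemma is_subgroupR (G : groupType) (P : G -> Prop) a b :
  is_subgroup P -> P a -> P b -> P [~ a, b].
Proof.
case=> _ PM PV Pa Pb; rewrite commgEl conjgE.
by apply: (PM); [|apply: (PM); [|apply: (PM)]]; rewrite //; apply: (PV).
Qed.

Lemma perfect_abelian (G : groupType) (P : G -> Prop) : is_perfect P ->
  (forall a b, P a -> P b -> commute a b) -> forall x, P x -> x = 1.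
Proof.
case=> _ pP cP; apply: pP (is_subgroup1 G) _ => a b Pa Pb.
exact/eqP/commgP/cP.
Qed.

Section MorphOn.
Variables (G H : groupType) (P : G -> Prop) (f : G -> H).
Hypotheses (sgP : is_subgroup P)
  (fM : forall x y, P x -> P y -> f (x * y) = f x * f y).

Lemma morph_on1 : f 1 = 1.
Proof.
by case: sgP => P1 _ _; apply: (@mulgI _ (f 1)); rewrite -fM // !mulg1.
Qed.

Lemma morph_onV x : P x -> f x^-1 = (f x)^-1.
Proof.
case: sgP => _ _ PV Px; apply: (@mulgI _ (f x)).
by rewrite -fM ?mulgV ?morph_on1 //; apply: (PV).
Qed.

Lemma morph_onR x y : P x -> P y -> f [~ x, y] = [~ f x, f y].
Proof.
case: sgP => _ PM PV Px Py; rewrite !commgEl !conjgE.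
rewrite !fM ?morph_onV //; try exact: (PV); try exact: (PM).
by apply: (PM); [apply: (PV) | apply: (PM)].
Qed.

Lemma perfect_image : is_perfect P ->
  is_perfect (fun y => exists2 x, P x & f x = y).
Proof.
case=> _ pP; have [P1 PM PV] := sgP; split.
  split; first by exists 1; rewrite ?morph_on1.
    by move=> _ _ [x Px <-] [y Py <-]; exists (x * y); rewrite ?fM //; apply: PM.
  by move=> _ [x Px <-]; exists x^-1; rewrite ?morph_onV //; apply: PV.
move=> Q [Q1 QM QV] cQ _ [x Px <-].
suff [] : P x /\ Q (f x) by [].
apply: (pP (fun x => P x /\ Q (f x))) Px.
  split; first by rewrite morph_on1.
    move=> u v [Pu Qu] [Pv Qv]; split; first exact: PM.
    by rewrite fM //; apply: QM.
  move=> u [Pu Qu]; split; first exact: PV.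
  by rewrite morph_onV //; apply: QV.
move=> a b Pa Pb; split; first exact: is_subgroupR.
by rewrite morph_onR //; apply: cQ; [exists a | exists b].
Qed.

End MorphOn.

Section GroupMorph.
Variables (G H : groupType) (f : G -> H).
Hypothesis fM : {morph f : x y / x * y}.

Lemma morphg1 : f 1 = 1.
Proof. by apply: (@mulgI _ (f 1)); rewrite -fM !mulg1. Qed.

Lemma morphgV x : f x^-1 = (f x)^-1.
Proof. by apply: (@mulgI _ (f x)); rewrite -fM !mulgV morphg1. Qed.

Lemma morphgR x y : f [~ x, y] = [~ f x, f y].
Proof. by rewrite !commgEl !conjgE !fM !morphgV. Qed.

End GroupMorph.

(** Multiplicativity is asked on [P] alone, since the combing map [last_strand] will be a
    homomorphism on pure braids and not on the whole braid group. *)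
Lemma no_perfect_image (G H : groupType) (P : G -> Prop) (K : H -> Prop)
    (f : G -> H) : is_perfect P ->
  (forall x y, P x -> P y -> f (x * y) = f x * f y) ->
  (forall x, P x -> K (f x)) -> no_perfect K -> forall x, P x -> f x = 1.
Proof.
move=> pP fM fK nK x Px; have [sgP _] := pP.
apply: (nK _ (perfect_image sgP fM pP)); last by exists x.
by move=> _ [y Py <-]; apply: fK.
Qed.

Definition derived (G : groupType) (P : G -> Prop) (x : G) :=
  forall Q : G -> Prop, is_subgroup Q ->
    (forall a b, P a -> P b -> Q [~ a, b]) -> Q x.

Lemma derived_subgroup (G : groupType) (P : G -> Prop) :
  is_subgroup (derived P).
Proof.
split=> [|x y dx dy|x dx] Q sQ cQ; have [Q1 QM QV] := sQ => //.
  by apply: QM; [apply: dx | apply: dy].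
by apply: QV; apply: dx.
Qed.

Lemma derived_comm (G : groupType) (P : G -> Prop) a b :
  P a -> P b -> derived P [~ a, b].
Proof. by move=> Pa Pb Q _; apply. Qed.

Lemma derived_normal (G : groupType) (P : G -> Prop) :
  (forall x z, P x -> P (x ^ z)) -> forall x z, derived P x -> derived P (x ^ z).
Proof.
move=> PJ x z; have [d1 dM dV] := derived_subgroup P.
apply: (fun sQ cQ (dx : derived P x) => dx (fun x => derived P (x ^ z)) sQ cQ).
  split; first by rewrite conj1g.
    by move=> u v du dv; rewrite conjMg; apply: dM.
  by move=> u du; rewrite conjVg; apply: dV.
by move=> a b Pa Pb; rewrite conjRg; apply: derived_comm; apply: PJ.
Qed.

Lemma commg_central (G : groupType) (p d x : G) :
  (forall y, commute p y) -> [~ p * d, x] = [~ d, x].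
Proof.
move=> cp; rewrite !commgEl !conjgE invgM -!mulgA; congr (_ * _).
by rewrite (mulgA x^-1) -(cp x^-1) -mulgA mulKg.
Qed.

(* The preimage of a perfect subgroup under a central extension need not be
   perfect, but its derived subgroup is, and still maps onto it. *)
Lemma no_perfect_central (G H : groupType) (f : G -> H)
    (K : G -> Prop) (L : H -> Prop) : {morph f : x y / x * y} ->
  (forall y, L y -> exists2 x, K x & f x = y) ->
  (forall x, f x = 1 -> forall y, commute x y) -> is_subgroup K ->
  no_perfect K -> no_perfect L.
Proof.
move=> fM LK fcent sK nK P pP PL.
have [sP dP] := pP; have [P1 PM PV] := sP.
pose P' x := P (f x); pose D := derived P'.
have sP' : is_subgroup P'.
  rewrite /P'; split=> [|x y|x]; rewrite ?(morphg1 fM) ?fM ?(morphgV fM) //.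
    exact: PM.
  exact: PV.
(* A central factor does not change a commutator, so a commutator is determined by the images of its
   two entries. *)
have commE a b d e : f a = f d -> f b = f e -> [~ a, b] = [~ d, e].
  move=> Ed Ee.
  have ca : forall y, commute (a * d^-1) y.
    by apply: fcent; rewrite fM (morphgV fM) Ed mulgV.
  have cb : forall y, commute (b * e^-1) y.
    by apply: fcent; rewrite fM (morphgV fM) Ee mulgV.
  have Ea : a = (a * d^-1) * d by rewrite mulgVK.
  have Eb : b = (b * e^-1) * e by rewrite mulgVK.
  move: (a * d^-1) (b * e^-1) ca cb Ea Eb => p q cp cq -> ->.
  by rewrite commg_central // -invgR commg_central // invgR.
have DK x : D x -> K x.
  apply=> // a b /PL /LK [d Kd Ed] /PL /LK [e Ke Ee].
  by rewrite (commE _ _ d e) //; apply: is_subgroupR.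
have dec y : P y -> exists2 d, D d & y = f d.
  have [D1 DM DV] := derived_subgroup P'.
  apply: (dP (fun y => exists2 d, D d & y = f d)).
    split; first by exists 1; rewrite ?(morphg1 fM).
      by move=> _ _ [d Dd ->] [e De ->]; exists (d * e); rewrite ?fM //; apply: DM.
    by move=> _ [d Dd ->]; exists d^-1; rewrite ?(morphgV fM) //; apply: DV.
  move=> a b Pa Pb; have [[a' _ Ea] [b' _ Eb]] := (LK a (PL a Pa), LK b (PL b Pb)).
  exists [~ a', b']; last by rewrite (morphgR fM) Ea Eb.
  by apply: derived_comm; rewrite /P' ?Ea ?Eb.
(* By [dec] and [commE] every commutator of [P'] is a commutator of elements of [D], so [D] is
   perfect; it lies in [K] by [DK]. *)
have D1 : forall d, D d -> d = 1.
  apply: nK => //; split=> [|Q sQ cQ x Dx]; first exact: derived_subgroup.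
  apply: Dx => // a b Pa Pb; have [[d Dd Ed] [e De Ee]] := (dec _ Pa, dec _ Pb).
  by rewrite (commE _ _ d e) //; apply: cQ.
by move=> x /dec [d /D1 -> ->]; rewrite (morphg1 fM).
Qed.

(** * Free groups have no perfect subgroups *)

Definition free_rel (I : choiceType) (u v : seq (I * bool)) := False.
Notation free_group I := (presented (@free_rel I)).

Section Magnus.
Import GRing.Theory Num.Theory.
Local Open Scope ring_scope.
Variables (I : choiceType) (T : seq I).
Local Notation L := (size T).
Local Notation word := (seq (I * bool)).

Hypothesis T_red : forall p i, onth T p = Some i -> onth T p.+1 <> Some i.

(* Magnus: [i] acts by a unipotent matrix that moves along the letters of [T]
   equal to [i], so that the product over a reduced word with syllables [T] has
   the product of the exponents as its upper right entry. *)
Definition mag_nil (i : I) : 'M[int]_L.+1 :=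
  \matrix_(p, q) ((q == p.+1 :> nat) && (onth T p == Some i))%:R.

Definition mag_gen (l : I * bool) : 'M[int]_L.+1 :=
  1 + (if l.2 then - mag_nil l.1 else mag_nil l.1).

Definition mag (u : word) : 'M[int]_L.+1 := \prod_(l <- u) mag_gen l.

Lemma mag_cat u v : mag (u ++ v) = mag u * mag v.
Proof. exact: big_cat. Qed.

Lemma mag_nil2 i : mag_nil i * mag_nil i = 0.
Proof.
apply/matrixP=> p q; rewrite !mxE big1 // => r _; rewrite !mxE.
case: (altP (r =P p.+1 :> nat)) => [rp|_] /=; last by rewrite mul0r.
case: eqP => [Tp|_]; last by rewrite mul0r.
by rewrite rp (introF eqP (T_red Tp)) andbF mulr0.
Qed.

Lemma mag_genV i b : mag_gen (i, b) * mag_gen (i, ~~ b) = 1.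
Proof.
rewrite /mag_gen /=; set N := mag_nil i.
have N2 : N * N = 0 by apply: mag_nil2.
case: b => /=; rewrite mulrDl !mulrDr !mul1r !mulr1 ?mulrN ?mulNr N2 ?oppr0 addr0.
  by rewrite addrK.
by rewrite subrK.
Qed.

Lemma mag_eq u v : pres_eq (@free_rel I) u v -> mag u = mag v.
Proof.
elim=> [//|{}u {}v _ //|{}u {}v w _ -> _ //|{}u u' {}v v' _ Eu _ Ev|i b|//].
  by rewrite !mag_cat Eu Ev.
by rewrite /mag !big_cons big_nil mulr1 mag_genV.
Qed.

Definition magF (x : free_group I) := mag (repr x).

Lemma magF_pi u : magF (\pi u) = mag u.
Proof. exact/mag_eq/pres_repr. Qed.

Lemma magFM x y : magF (x * y)%g = magF x * magF y.
Proof. by rewrite /magF -mag_cat; apply/mag_eq/pres_repr. Qed.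

Lemma magF1 : magF 1%g = 1.
Proof. by rewrite [magF _]magF_pi /mag big_nil. Qed.

Definition deep (c : nat) (A : 'M[int]_L.+1) :=
  forall p q : 'I_L.+1, (q < p + c)%N -> A p q = 0.

Lemma deepD c A B : deep c A -> deep c B -> deep c (A + B).
Proof. by move=> dA dB p q pq; rewrite mxE dA ?dB ?addr0. Qed.

Lemma deepN c A : deep c A -> deep c (- A).
Proof. by move=> dA p q pq; rewrite mxE dA ?oppr0. Qed.

Lemma deepM c d A B : deep c A -> deep d B -> deep (c + d) (A * B).
Proof.
move=> dA dB p q pq; rewrite mxE big1 // => r _.
have [rp|rp] := ltnP r (p + c); first by rewrite dA ?mul0r.
by rewrite dB ?mulr0 //; lia.
Qed.

Lemma deepW c d A : (d <= c)%N -> deep c A -> deep d A.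
Proof. by move=> dc dA p q pq; apply: dA; lia. Qed.

Lemma deep1 : deep 0 1.
Proof.
move=> p q pq; rewrite mxE; case: eqP => // E.
by move: pq; rewrite E addn0 ltnn.
Qed.

Lemma mag_deep u : deep 1 (mag u - 1).
Proof.
elim: u => [|[i b] u IHu]; first by rewrite /mag big_nil subrr => p q; rewrite mxE.
rewrite /mag big_cons -/(mag u).
have -> : mag_gen (i, b) * mag u - 1 =
    (mag u - 1) + (mag_gen (i, b) - 1) * ((mag u - 1) + 1).
  by rewrite subrK mulrBl mul1r [RHS]addrC addrA subrK.
have dN : deep 1 (mag_nil i).
  by move=> p q pq; rewrite mxE; case: eqP => // E; move: pq; lia.
have dG : deep 1 (mag_gen (i, b) - 1).
  by rewrite /mag_gen addrC addKr; case: b => //=; apply: deepN.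
apply: deepD => //; apply: (@deepM 1 0) => //.
apply: deepD deep1; exact: deepW IHu.
Qed.

Definition mag_filt (c : nat) (x : free_group I) := deep c (magF x - 1).

Lemma magF_deep0 x : deep 0 (magF x).
Proof.
rewrite -[magF x](subrK 1); apply: deepD deep1.
by apply: deepW (mag_deep _).
Qed.

Lemma magFV x : magF x^-1%g * magF x = 1.
Proof. by rewrite -magFM mulVg magF1. Qed.

Lemma mag_filt_subgroup c : is_subgroup (mag_filt c).
Proof.
rewrite /mag_filt; split=> [|x y dx dy|x dx].
- by rewrite magF1 subrr => p q _; rewrite mxE.
- have -> : magF (x * y)%g - 1 = (magF x - 1) * magF y + (magF y - 1).
    by rewrite magFM mulrBl mul1r addrA subrK.
  by apply: deepD => //; rewrite -[c]addn0; apply: deepM => //; apply: magF_deep0.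
- have -> : magF x^-1%g - 1 = - (magF x^-1%g * (magF x - 1)).
    by rewrite mulrBr mulr1 magFV opprB.
  by apply/deepN; rewrite -[c]add0n; apply: deepM => //; apply: magF_deep0.
Qed.

(** With matrices x = 1 + a and y = 1 + b one has yx([x, y] - 1) = xy - yx = ab - ba, and depths add
    up in products. *)
Lemma mag_filtR c x y : mag_filt c x -> mag_filt c y ->
  mag_filt (c + c) [~ x, y]%g.
Proof.
rewrite /mag_filt => dx dy.
have E : magF (y * x)%g * (magF [~ x, y]%g - 1) =
    (magF x - 1) * (magF y - 1) - (magF y - 1) * (magF x - 1).
  rewrite mulrBr mulr1 -magFM -commgC !magFM.
  rewrite !mulrBr !mulrBl !mulr1 !mul1r.
  move: (_ * _) (_ * _) => A B; apply/matrixP=> p q; rewrite !mxE.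
  ring.
have -> : magF [~ x, y]%g - 1 = magF (y * x)^-1%g *
    ((magF x - 1) * (magF y - 1) - (magF y - 1) * (magF x - 1)).
  by rewrite -E mulrA magFV mul1r.
rewrite -[(c + c)%N]add0n; apply: deepM; first exact: magF_deep0.
by apply: deepD; [|apply: deepN]; apply: deepM.
Qed.

(** Commutators double the depth, so a perfect subgroup lies in every [mag_filt c], and a matrix of
    size [L.+1] and depth [L.+1] is zero. *)
Lemma perfect_magF P : is_perfect P -> forall x, P x -> magF x = 1.
Proof.
move=> [_ pP] x Px.
have dP c y : P y -> mag_filt c.+1 y.
  elim: c y => [y _|c IHc]; first exact: mag_deep.
  apply: (pP); first exact: mag_filt_subgroup.
  move=> a b Pa Pb; have := mag_filtR (IHc a Pa) (IHc b Pb).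
  by apply: deepW; lia.
apply/eqP; rewrite -subr_eq0; apply/eqP/matrixP=> p q.
by rewrite (dP L x Px) ?mxE //; have := ltn_ord q; lia.
Qed.

End Magnus.

Section FreeResidual.
Import GRing.Theory Num.Theory.
Local Open Scope ring_scope.
Variable I : choiceType.
Local Notation syllable := (I * bool * nat)%type.

(** The exponent is shifted by one so that no syllable is empty. *)
Definition syl_word (s : syllable) := nseq s.2.+1 s.1.
Definition syl_words (S : seq syllable) := flatten (map syl_word S).
Definition syl_idx (s : syllable) : I := s.1.1.
Definition syl_red (S : seq syllable) :=
  sorted (fun i j : I => i != j) (map syl_idx S).

Lemma syl_redP S p i : syl_red S ->
  onth (map syl_idx S) p = Some i -> onth (map syl_idx S) p.+1 <> Some i.
Proof.
rewrite /syl_red; move: (map _ _) => T; elim: T p => [|j T IHT] [|p] //=.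
  by case: T {IHT} => [|k T] //= /andP[jk _] [<-] [] kj; rewrite kj eqxx in jk.
by move=> /path_sorted; apply: IHT.
Qed.

Lemma syl_exists u : exists2 S, syl_red S & pres_eq (@free_rel I) u (syl_words S).
Proof.
elim: u => [|[i b] u [S rS uS]]; first by exists [::] => //; apply: pres_refl.
have E : pres_eq (@free_rel I) ((i, b) :: u) ((i, b) :: syl_words S).
  exact: pres_cat (pres_refl _ [:: (i, b)]) uS.
case: S rS uS E => [|[[j c] n] S] rS uS E; first by exists [:: (i, b, 0%N)].
have [ij|ij] := eqVneq i j; last first.
  by exists [:: (i, b, 0%N), (j, c, n) & S] => //; rewrite /syl_red /= ij.
rewrite -{}ij in rS uS E.
have [bc|bc] := eqVneq b c.
  by rewrite -{}bc in rS uS E; exists ((i, b, n.+1) :: S).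
have {}bc : c = ~~ b by case: b c bc {E uS rS} => [] [].
rewrite {}bc in rS uS E.
case: n rS uS E => [|n] rS uS E; last first.
  exists ((i, ~~ b, n) :: S) => //; apply: pres_trans E _.
  exact: (pres_cat (pres_cancel _ i b) (pres_refl _ (syl_words ((i, ~~ b, n) :: S)))).
exists S; first exact: path_sorted rS.
apply: pres_trans E _.
exact: (pres_cat (pres_cancel _ i b) (pres_refl _ (syl_words S))).
Qed.

Lemma mag_syl (T : seq I) (s : syllable) :
    (forall p i, onth T p = Some i -> onth T p.+1 <> Some i) ->
  mag T (syl_word s) =
  1 + (if s.1.2 then - mag_nil T s.1.1 else mag_nil T s.1.1) *+ s.2.+1.
Proof.
move=> Tred; case: s => [[i b] n]; rewrite /syl_word /=.
elim: n => [|n IHn]; first by rewrite /mag /= big_seq1 mulr1n.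
have -> : mag T (nseq n.+2 (i, b)) = mag_gen T (i, b) * mag T (nseq n.+1 (i, b)).
  by rewrite /mag big_cons.
rewrite IHn /mag_gen /=; set N := if b then _ else _.
have N2 : N * N = 0.
  by rewrite /N; case: b {IHn N}; rewrite ?mulrN ?mulNr mag_nil2 // !oppr0.
rewrite mulrDl !mulrDr !mul1r !mulr1 mulrnAr N2 mul0rn addr0 -addrA; congr (_ + _).
by rewrite addrC -mulrS.
Qed.

(** A syllable moves entries of the first row by at most one column. Syllable number [j] carries the
    last nonzero entry from column [j] to column [j.+1] and multiplies it by plus or minus its
    exponent, which is nonzero in [int]. *)
Lemma mag_row0 (S : seq syllable) (rS : syl_red S) j :
    (j <= size S)%N ->
  forall q : 'I_(size (map syl_idx S)).+1, (j <= q)%N ->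
  (mag (map syl_idx S) (syl_words (take j S)) ord0 q == 0) = (q != j :> nat).
Proof.
set T := map syl_idx S; have Tred := fun p i => @syl_redP S p i rS.
elim: j => [|j IHj] jS q jq.
  rewrite take0 /mag big_nil mxE -val_eqE /=.
  by case: (nat_of_ord q).
have {}IHj := IHj (ltnW jS).
have [s0 _] : exists s0 : syllable, true by case: (S) jS => // s0; exists s0.
rewrite (take_nth s0) // /syl_words map_rcons flatten_rcons mag_cat -/(syl_words _).
rewrite mag_syl //; set s := nth s0 S j.
have jT : (j < (size T).+1)%N by rewrite size_map ltnW.
have P0 (r : 'I_(size T).+1) : (j < r)%N -> mag T (syl_words (take j S)) ord0 r = 0.
  by move=> jr; apply/eqP; rewrite IHj ?gtn_eqF // ltnW.
rewrite mulrDr mulr1 mxE P0 // add0r -scaler_nat -scalerAr mxE.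
rewrite natz mulf_eq0 /=.
rewrite mxE (bigD1 (Ordinal jT)) //= big1 => [|r rj]; last first.
  have [qr|qr] := eqVneq (q : nat) r.+1; last first.
    by case: ifP => _; rewrite !mxE (negbTE qr) ?oppr0 mulr0.
  have jr : (j < r)%N by rewrite ltn_neqAle -ltnS -qr jq andbT eq_sym; move: rj; rewrite -val_eqE.
  by rewrite P0 ?mul0r.
rewrite addr0 mulf_eq0 IHj //= eqxx /=.
have Tj : onth T j = Some s.1.1.
  by rewrite /T onthE -map_comp (nth_map s0).
case: ifP => _; rewrite !mxE /= Tj eqxx andbT ?oppr_eq0;
  by case: (_ == j.+1).
Qed.

Theorem free_no_perfect : no_perfect (fun _ : free_group I => True).
Proof.
move=> P pP _ x Px; have [S rS xS] := syl_exists (repr x).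
have Tred := fun p i => @syl_redP S p i rS.
have xE : x = \pi_(free_group I) (syl_words S) by rewrite -[LHS]reprK; apply/pres_piP.
have := perfect_magF Tred pP Px.
(* The upper right corner of the product over [S] is nonzero, while that of the identity matrix is
   zero unless [S] is empty. *)
rewrite xE magF_pi // => /matrixP /(_ ord0 ord_max).
have /= := @mag_row0 S rS (size S) (leqnn _) ord_max.
have szT : size (map syl_idx S) = size S by rewrite size_map.
rewrite take_size [X in (_ <= X)%N]szT => /(_ (leqnn _)) + E.
rewrite E mxE -val_eqE /= szT eqxx /=.
by case: (S) => [|s S'].
Qed.

End FreeResidual.

(** * The coset action of braid generators *)

(** Here [k] counts generators, so there are [k.+1] strands; the terms from [k] on are
    unconstrained. *)
Definition braid_seq (G : groupType) (k : nat) (s : nat -> G) :=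
  (forall i j, i.+1 < j < k -> commute (s i) (s j)) /\
  (forall i, i.+1 < k -> s i * s i.+1 * s i = s i.+1 * s i * s i.+1).

Lemma braid_seq_le (G : groupType) k m (s : nat -> G) :
  m <= k -> braid_seq k s -> braid_seq m s.
Proof.
by move=> mk [far adj]; split=> [i j ij|i im]; [apply: far; lia | apply: adj; lia].
Qed.

Lemma braid_seqV (G : groupType) k (s : nat -> G) :
  braid_seq k s -> braid_seq k (fun i => (s i)^-1).
Proof.
case=> far adj; split=> [i j ij|i ik].
  by apply/commuteV/commute_sym/commuteV/commute_sym/far.
by rewrite -!invgM !mulgA adj.
Qed.

(** The indices go down from [j + d - 1] to [j]; these words serve as coset representatives, moving
    the last strand to position [j]. *)
Fixpoint desc (G : groupType) (s : nat -> G) (j d : nat) : G :=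
  if d is d'.+1 then s (j + d') * desc s j d' else 1.

Section Desc.
Variables (G : groupType) (k : nat) (s : nat -> G).
Hypothesis sb : braid_seq k s.
Let far := sb.1.
Let adj := sb.2.

Lemma braid_comm i j : i < k -> j < k -> i.+1 < j \/ j.+1 < i ->
  commute (s i) (s j).
Proof.
move=> ik jk [ij|ji]; first by apply: far; rewrite ij.
by apply/commute_sym/far; rewrite ji.
Qed.

Lemma desc_recl j d : desc s j d.+1 = desc s j.+1 d * s j.
Proof.
elim: d => [|d IHd]; first by rewrite /= addn0 mul1g mulg1.
by rewrite -[LHS]/(s (j + d.+1) * desc s j d.+1) IHd mulgA addnS.
Qed.

Lemma desc_commute g j d :
  (forall i, j <= i < j + d -> commute g (s i)) -> commute g (desc s j d).
Proof.
elim: d => [|d IHd] cg /=; first exact: commute1.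
by apply: commuteM; [apply: cg; lia | apply: IHd => i ij; apply: cg; lia].
Qed.

Lemma desc_far i j d : i < k -> j + d <= k -> i.+1 < j \/ j + d < i ->
  commute (s i) (desc s j d).
Proof. by move=> ik jk ij; apply: desc_commute => m jm; apply: braid_comm; lia. Qed.

Lemma desc_conj i j d : j <= i -> i.+1 < j + d -> j + d <= k ->
  desc s j d * s i.+1 = s i * desc s j d.
Proof.
elim: d => [|d IHd] ji id jk /=; first by lia.
have [E|N] := eqVneq i.+1 (j + d); last first.
  have ij' : i.+1 < j + d by move/eqP: N; lia.
  rewrite -mulgA IHd //; last by lia.
  by rewrite !mulgA; congr (_ * _); apply: braid_comm; lia.
case: d IHd id jk E => [|d] IHd id jk E /=; first by lia.
have Ei : j + d = i by lia.
rewrite -E Ei -!mulgA -(@desc_far i.+1 j d); try lia.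
by rewrite !mulgA adj //; lia.
Qed.

End Desc.

(* The relations between the generators [s] of a braid group and a free basis
   [x] of the normal subgroup of the braids in which only the last strand
   moves. *)
Definition comb (G : groupType) (k : nat) (s x : nat -> G) :=
  [/\ forall m i, m < k -> i <= k -> i != m -> i != m.+1 -> commute (s m) (x i),
      forall i, i < k -> s i * x i = x i.+1 * s i &
      forall i, i < k -> commute (s i) (x i * x i.+1)].

Section CosetStep.
Variables (H : groupType) (k : nat) (t : nat -> H).
Hypothesis tb : braid_seq k.+1 t.
Local Notation c j := (desc t j (k.+1 - j)).

(** Since [c j] is [c j.+1 * t j], this is the square of [t j] conjugated by [c j.+1]: the standard
    pure generator in which the last strand encircles the strand [j]. *)
Definition loop_elt j := c j * t j * (c j.+1)^-1.

Lemma coset_lt i j : i.+1 < j -> j <= k.+1 -> c j * t i = t i * c j.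
Proof. by move=> ij jk; apply/commute_sym/(desc_far tb); lia. Qed.

Lemma coset_pred i : i <= k -> c i.+1 * t i = c i.
Proof. by move=> ik; rewrite (subSn ik) desc_recl. Qed.

Lemma coset_eq i : c i * t i = loop_elt i * c i.+1.
Proof. by rewrite mulgVK. Qed.

Lemma coset_gt i j : j <= i -> i < k -> c j * t i.+1 = t i * c j.
Proof. by move=> ji ik; apply: (desc_conj tb); lia. Qed.

(* Each relation is a braid relation read from a coset representative. *)
Lemma loop_comb : comb k t loop_elt.
Proof.
have adj i : i < k -> t i * t i.+1 * t i = t i.+1 * t i * t i.+1.
  by move=> ik; apply: tb.2; lia.
have coset_eqA := coset_eq; move: loop_elt coset_eqA => A coset_eqA.
split=> [m i mk ik im im1|i ik|i ik].
- have [mi|mi] := leqP m.+2 i.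
    have E : c i * t m * t i = c i * t i * t m.
      by rewrite -!mulgA; congr (_ * _); apply: (braid_comm tb); lia.
    move: E; rewrite (coset_lt mi (leqW ik)) -[LHS]mulgA coset_eqA -[RHS]mulgA.
    by rewrite (@coset_lt m i.+1) ?(leqW mi) // !mulgA => /mulIg.
  have {}mi : i < m by lia.
  have E : c i * t m.+1 * t i = c i * t i * t m.+1.
    by rewrite -!mulgA; congr (_ * _); apply: (braid_comm tb); lia.
  move: E; rewrite (coset_gt (ltnW mi) mk) -[LHS]mulgA coset_eqA -[RHS]mulgA.
  by rewrite (coset_gt mi mk) !mulgA => /mulIg.
- have := congr1 (mulg (c i.+1)) (adj i ik).
  rewrite !mulgA (coset_pred (ltnW ik)) coset_gt // coset_eqA.
  rewrite -(mulgA (t i)) coset_eqA -(mulgA (A _)) coset_lt; try lia.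
  by rewrite !mulgA -(mulgA _ (c i.+2)) coset_pred // => /mulIg.
- have := congr1 (mulg (c i)) (adj i ik).
  rewrite !mulgA coset_eqA -(mulgA (A i)) coset_eqA (mulgA (A i)).
  rewrite -(mulgA _ (c i.+2)) coset_lt; try lia.
  rewrite coset_gt // -(mulgA _ (c i)) coset_eqA -!mulgA coset_eqA !mulgA.
  by move=> /mulIg; rewrite /commute !mulgA.
Qed.
End CosetStep.

Section PresAct.
Variables (I : choiceType) (R : seq (I * bool) -> seq (I * bool) -> Prop).
Variables (T : Type) (D : T -> Prop) (a : T -> I * bool -> T).
Hypotheses (aD : forall t l, D t -> D (a t l))
  (aK : forall t i b, D t -> a (a t (i, b)) (i, ~~ b) = t)
  (aR : forall u v, R u v -> forall t, D t -> foldl a t u = foldl a t v).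

Lemma act_dom u t : D t -> D (foldl a t u).
Proof. by elim: u t => //= l u IHu t Dt; apply/IHu/aD. Qed.

(** The invariant domain [D] is there for the coset action, whose relations are checked at positions
    up to [k.+1]. *)
Lemma pres_act u v t : pres_eq R u v -> D t -> foldl a t u = foldl a t v.
Proof.
move=> uv; elim: uv t => {u v}
    [//|u v _ IH t /IH|u v w _ IH1 _ IH2 t Dt|u u' v v' _ IH1 _ IH2 t Dt|i b t Dt|u v Ruv t Dt] //.
- by rewrite IH1 // IH2.
- by rewrite !foldl_cat IH1 // IH2 //; apply: act_dom.
- exact: aK.
- exact: aR.
Qed.

End PresAct.

(* Right action of the braid generators on the cosets [(g, p)], standing for
   [g * c p], of the subgroup of braids that fix the last strand. *)
Definition coset_step (G : groupType) (s x : nat -> G) (t : G * nat)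
    (l : nat * bool) : G * nat :=
  let: (g, p) := t in let: (i, b) := l in
  let inv y := if b then y^-1 else y in
  if i.+1 < p then (g * inv (s i), p)
  else if i.+1 == p then (if b then (g * (x i)^-1, i) else (g, i))
  else if i == p then (if b then (g, p.+1) else (g * x i, p.+1))
  else (g * inv (s i.-1), p).

Definition pos_step (p i : nat) : nat :=
  if i.+1 == p then i else if i == p then p.+1 else p.

Section CosetAction.
Variables (G : groupType) (s x : nat -> G).
Local Notation a := (coset_step s x).
Local Notation act := (foldl (coset_step s x)).

Lemma coset_step_pos t l : (a t l).2 = pos_step t.2 l.1.
Proof.
case: t l => [g p] [i b] /=; rewrite /pos_step.
case: ltngtP => [ip|pi|_]; last by case: b.
  by case: eqP => // E; lia.
by case: eqP => // _; case: b.
Qed.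

Lemma coset_act_pos t u : (act t u).2 = foldl pos_step t.2 (map fst u).
Proof. by elim: u t => //= l u IHu t; rewrite IHu coset_step_pos. Qed.

Lemma coset_stepM h g p l :
  a (h * g, p) l = (h * (a (g, p) l).1, (a (g, p) l).2).
Proof.
case: l => [i b] /=.
by do ?case: ifP => _; rewrite /= ?mulgA //; case: b; rewrite /= ?mulgA.
Qed.

(** The letters act on the right and [G] on the left. This makes the action multiplicative on the
    braids that lead back to the base position. *)
Lemma coset_actM h g p u :
  act (h * g, p) u = (h * (act (g, p) u).1, (act (g, p) u).2).
Proof.
elim: u g p => [//|l u IHu] g p.
have actE t : act t (l :: u) = act (a t l) u by [].
by rewrite !actE coset_stepM; case: (a (g, p) l) => g' p'; rewrite IHu.
Qed.

Lemma coset_stepK t i b : a (a t (i, b)) (i, ~~ b) = t.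
Proof.
case: t => [g p] /=.
have [ip|pi|ip] := ltngtP i.+1 p.
- by case: b; rewrite /= ip ?mulgK ?mulgVK.
- have [E|N] := eqVneq i p.
    by rewrite -E; case: b; rewrite /= ltnn eqxx ?mulgK.
  by case: b; rewrite /= ltnNge (ltnW pi) gtn_eqF //= (negbTE N) ?mulgK ?mulgVK.
- by rewrite -ip; case: b; rewrite /= ltnNge leqnSn gtn_eqF // eqxx ?mulgVK.
Qed.

Variable k : nat.
Hypotheses (sb : braid_seq k s) (cb : comb k s x).

Lemma coset_step_dom t i b : i <= k -> t.2 <= k.+1 -> (a t (i, b)).2 <= k.+1.
Proof. by move=> ik tk; rewrite coset_step_pos /pos_step /=; do ?case: eqP; lia. Qed.

Lemma step_lt g p i : i.+1 < p -> a (g, p) (i, false) = (g * s i, p).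
Proof. by move=> ip /=; rewrite ip. Qed.
Lemma step_pred g i : a (g, i.+1) (i, false) = (g, i).
Proof. by rewrite /= ltnn eqxx. Qed.
Lemma step_eq g i : a (g, i) (i, false) = (g * x i, i.+1).
Proof. by rewrite /= ltnNge leqnSn gtn_eqF // eqxx. Qed.
Lemma step_gt g p i : p <= i -> a (g, p) (i.+1, false) = (g * s i, p).
Proof. by move=> pi /=; rewrite ltnNge leqW ?leqW // !gtn_eqF // ltnS // leqW. Qed.

Lemma coset_far g p i j : i.+1 < j -> j <= k -> p <= k.+1 ->
  act (g, p) [:: (i, false); (j, false)] = act (g, p) [:: (j, false); (i, false)].
Proof.
have [c1 c2 c3] := cb; case: j => // j ij jk pk; rewrite /foldl.
have sc m n : m < k -> n < k -> m.+1 < n -> s m * s n = s n * s m.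
  by move=> mk nk mn; apply: sb.1; rewrite mn.
have [pi|ip|->] := ltngtP p i.
- case: i ij pi => // i ij pi; rewrite !step_gt ?ltnS //; try lia.
  by rewrite -!mulgA sc //; lia.
- have [->|pi1] := eqVneq p i.+1; first by rewrite step_pred !step_gt ?step_pred //; lia.
  have {}ip : i.+1 < p by lia.
  rewrite (step_lt _ ip); have [pj|jp|E] := ltngtP p j.+1.
  + by rewrite !step_gt ?(step_lt _ ip) //; try lia; rewrite -!mulgA sc //; lia.
  + have [->|pj1] := eqVneq p j.+2; first by rewrite !step_pred step_lt //; lia.
    have jp' : j.+2 < p by lia.
    by rewrite !(step_lt _ jp') (step_lt _ ip) -!mulgA sc //; lia.
  + rewrite E !step_eq step_lt; last by lia.
    by rewrite -!mulgA c1 //; lia.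
- by rewrite step_gt ?step_eq ?step_gt ?step_eq -?mulgA ?c1 //; lia.
Qed.

(** The position decides which relation is called for: the third clause of [comb] at [i], the second
    at [i.+1], none at [i.+2], and the braid relation of [s] elsewhere. The first clause of [comb]
    serves in [coset_far]. *)
Lemma coset_adj g p i : i < k -> p <= k.+1 ->
  act (g, p) [:: (i, false); (i.+1, false); (i, false)] =
  act (g, p) [:: (i.+1, false); (i, false); (i.+1, false)].
Proof.
have [c1 c2 c3] := cb; move=> ik pk; rewrite /foldl.
have [pi|ip|->] := ltngtP p i.
- case: i ik pi => // i ik pi; rewrite !step_gt //; try lia.
  by rewrite -!mulgA (mulgA (s i)) sb.2 // !mulgA.
- have [->|pi1] := eqVneq p i.+1.
    rewrite step_pred step_gt // step_eq step_eq step_lt // step_pred.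
    by rewrite -!mulgA c2.
  have [->|pi2] := eqVneq p i.+2.
    by rewrite step_pred step_lt // step_pred step_pred step_pred step_gt.
  have ip1 : i.+1 < p by lia.
  have ip2 : i.+2 < p by lia.
  rewrite !(step_lt _ ip1) !(step_lt _ ip2) !(step_lt _ ip1).
  by rewrite !(step_lt _ ip2) -!mulgA (mulgA (s i)) sb.2 ?mulgA //; lia.
- rewrite (step_gt _ (leqnn i)) !step_eq (step_lt _ (ltnSn i.+1)).
  by rewrite -!mulgA (mulgA (x i)) -c3 // !mulgA.
Qed.

End CosetAction.

(* When [e] maps [s], [x] to the generators [t] and the loops, the coset action
   computes in the target group. *)
Section CosetEval.
Variables (G H : groupType) (s x : nat -> G) (e : G -> H) (k : nat) (t : nat -> H).
Hypotheses (eM : {morph e : g h / g * h}) (tb : braid_seq k.+1 t)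
  (es : forall i, i < k -> e (s i) = t i)
  (ex : forall i, i <= k -> e (x i) = loop_elt k t i).
Local Notation c j := (desc t j (k.+1 - j)).
Local Notation value y := (e y.1 * c y.2).

Lemma coset_step_eval y i b : i <= k -> y.2 <= k.+1 ->
  value (coset_step s x y (i, b)) = value y * (if b then (t i)^-1 else t i).
Proof.
wlog -> : y b / b = false => [IH|ik yk].
  case: b => ik yk; last exact: IH.
  apply: (@mulIg _ (t i)); rewrite mulgVK.
  rewrite -(IH (coset_step s x y (i, true)) false) //.
    by rewrite (coset_stepK s x y i true).
  exact: coset_step_dom.
case: y yk => [g p] /= pk.
have [ip|pi|ip] := ltngtP i.+1 p.
- by rewrite /= eM es -?mulgA ?(coset_lt tb) //; lia.
- have [E|N] := eqVneq i p.
    by rewrite -E /= eM ex // -[RHS]mulgA coset_eq [RHS]mulgA.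
  case: i ik pi N => [|i] ik pi N; first by lia.
  by rewrite /= eM es -?mulgA ?(coset_gt tb) //; lia.
- by rewrite -ip /= -mulgA coset_pred.
Qed.

End CosetEval.

(** * Combing plane braids *)

Lemma word_eval_cons (I : choiceType) (G : groupType) (f : I -> G) l u :
  word_eval f (l :: u) = (if l.2 then (f l.1)^-1 else f l.1) * word_eval f u.
Proof. exact: big_cons. Qed.

Lemma word_eval_nil (I : choiceType) (G : groupType) (f : I -> G) :
  word_eval f [::] = 1.
Proof. exact: big_nil. Qed.

Section Presented.
Variables (I : choiceType) (R : seq (I * bool) -> seq (I * bool) -> Prop).
Local Notation gen := (pres_gen R).

Lemma presM u v : \pi_(presented R) u * \pi_(presented R) v = \pi_(presented R) (u ++ v).
Proof. exact: pres_mulE. Qed.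

Lemma pres_word u : word_eval gen u = \pi_(presented R) u.
Proof. by rewrite pres_prod_gen. Qed.

Lemma pres_gen_rel u v : R u v -> word_eval gen u = word_eval gen v.
Proof. by move=> uv; rewrite !pres_word; apply/pres_piP/pres_rel. Qed.

Lemma pres_subgroup (Q : presented R -> Prop) :
  is_subgroup Q -> (forall i, Q (gen i)) -> forall x, Q x.
Proof.
case=> Q1 QM QV Qg x; rewrite -[x]reprK -pres_word.
elim: (repr x) => [|[i b] u IHu]; first by rewrite word_eval_nil.
rewrite word_eval_cons; apply: QM => //=.
by case: b => //; apply: QV.
Qed.

Lemma pres_hom_ext (H : groupType) (f g : presented R -> H) :
  {morph f : x y / x * y} -> {morph g : x y / x * y} ->
  (forall i, f (gen i) = g (gen i)) -> f =1 g.
Proof.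
move=> fM gM fg; apply: pres_subgroup => //; split=> [|x y|x].
- by rewrite !morphg1.
- by rewrite fM gM => -> ->.
- by rewrite !morphgV // => ->.
Qed.

Lemma pres_hom_word (H : groupType) (f : presented R -> H) u :
  {morph f : x y / x * y} -> f (\pi_(presented R) u) = word_eval (fun i => f (gen i)) u.
Proof.
move=> fM; rewrite -pres_word; elim: u => [|[i b] u IHu].
  by rewrite !word_eval_nil morphg1.
rewrite !word_eval_cons fM -IHu /=; congr (_ * _).
by case: b; rewrite ?morphgV.
Qed.

End Presented.

(* Families on ordinals are extended by 1, to be indexed by natural numbers. *)
Definition tot (G : groupType) k (f : 'I_k -> G) (i : nat) : G :=
  if insub i is Some o then f o else 1.

Lemma totE (G : groupType) k (f : 'I_k -> G) (o : 'I_k) : tot f o = f o.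
Proof. by rewrite /tot valK. Qed.

Lemma totEP (G : groupType) k (f : 'I_k -> G) i (ik : i < k) :
  tot f i = f (Ordinal ik).
Proof. exact: (totE f (Ordinal ik)). Qed.

Lemma braid_seq_word X n (H : groupType) (f : 'I_n.-1 -> H) :
  (forall u v, @braid_rel X n u v -> word_eval f u = word_eval f v) ->
  braid_seq n.-1 (tot f).
Proof.
move=> fr; split=> [i j /andP[ij jn]|i iN].
  have iN : i < n.-1 by lia.
  have := fr _ _ (@braid_rel_far X n (Ordinal iN) (Ordinal jn) ij).
  by rewrite !word_eval_cons !word_eval_nil /= !mulg1 !totEP.
have iN' := ltnW iN.
have := fr _ _ (@braid_rel_adj X n (Ordinal iN') (Ordinal iN) (erefl _)).
by rewrite !word_eval_cons !word_eval_nil /= !mulg1 !totEP !mulgA.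
Qed.

Lemma braid_rel_Cplane n (H : groupType) (f : nat -> H) :
  braid_seq n.-1 f -> forall u v, @braid_rel Cplane n u v ->
  word_eval (fun i : 'I_n.-1 => f i) u = word_eval (fun i : 'I_n.-1 => f i) v.
Proof.
case=> far adj u v; case=> // i j ij.
  by rewrite !word_eval_cons !word_eval_nil /= !mulg1; apply: far; rewrite ij ltn_ord.
have jn : i.+1 < n.-1 by rewrite -ij.
by rewrite !word_eval_cons !word_eval_nil /= !mulg1 ij !mulgA adj.
Qed.

Definition sg X n : nat -> braid_group X n := tot (@sigma X n).

Lemma sg_braid X n : braid_seq n.-1 (sg X n).
Proof. by apply: (@braid_seq_word X) => u v uv; apply: pres_gen_rel. Qed.

Definition nat_letter n (l : 'I_n * bool) : nat * bool := (nat_of_ord l.1, l.2).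

Lemma adj_tpermE n (i : 'I_n.-1) (o : 'I_n) :
  adj_tperm i o = pos_step o i :> nat.
Proof.
rewrite /adj_tperm /pos_step; case: tpermP => [->|->|/eqP Nlo /eqP Nhi] /=.
- by rewrite eqxx gtn_eqF.
- by rewrite eqxx.
- rewrite -val_eqE /= in Nlo; rewrite -val_eqE /= in Nhi.
  by rewrite !(eq_sym _ (o : nat)) (negbTE Nlo) (negbTE Nhi).
Qed.

Lemma braid_permE X n u (o : 'I_n) :
  braid_perm (\pi_(braid_group X n) u) o =
  foldl pos_step o (map fst (map (@nat_letter _) u)) :> nat.
Proof.
rewrite /braid_perm pres_liftE; last exact: adj_tperm_rel.
elim: u o => [|[i b] u IHu] o; first by rewrite word_eval_nil perm1.
rewrite word_eval_cons permM IHu /=.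
by case: b; rewrite /= ?tpermV adj_tpermE.
Qed.

Lemma pure_braidP X n (b : braid_group X n) : pure_braids X n b <->
  forall p, p < n -> foldl pos_step p (map fst (map (@nat_letter _) (repr b))) = p.
Proof.
have E : b = \pi_(braid_group X n) (repr b) by rewrite reprK.
rewrite /pure_braids /=; split=> [b1 p pn|bp].
  by have := braid_permE X (repr b) (Ordinal pn); rewrite -E b1 perm1.
by apply/permP=> o; apply: val_inj; rewrite perm1 [in LHS]E /= braid_permE bp.
Qed.

Section ArtinAction.
Variable k : nat.
Local Notation B := (braid_group Cplane k.+1).
Local Notation F := (free_group 'I_k.+1).

Definition fgen : nat -> F := tot (@pres_gen _ (@free_rel 'I_k.+1)).

(** Artin's automorphisms, in the convention forced by [comb]: the letter acts as conjugation of the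
    loops by the generator, on the right. *)
Definition artin_gen (l : 'I_k * bool) (m : nat) : F :=
  let: (i, b) := l in
  if b then
    if m == i then fgen i.+1
    else if m == i.+1 then (fgen i.+1)^-1 * fgen i * fgen i.+1 else fgen m
  else
    if m == i then fgen i * fgen i.+1 * (fgen i)^-1
    else if m == i.+1 then fgen i else fgen m.

Definition artin_step (f : F) (l : 'I_k * bool) : F :=
  pres_lift (fun m : 'I_k.+1 => artin_gen l m) f.

Lemma artin_stepM l : {morph artin_step ^~ l : f g / f * g}.
Proof. exact: pres_liftM. Qed.

Lemma artin_step_gen l m : m <= k -> artin_step (fgen m) l = artin_gen l m.
Proof. by move=> mk; rewrite /artin_step /fgen totEP pres_lift_gen. Qed.

Definition artin_word (f : F) (u : seq ('I_k * bool)) := foldl artin_step f u.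

Lemma artin_wordM u : {morph artin_word ^~ u : f g / f * g}.
Proof. by elim: u => //= l u IHu f g; rewrite artin_stepM IHu. Qed.

Lemma free_hom_ext (f g : F -> F) :
  {morph f : x y / x * y} -> {morph g : x y / x * y} ->
  (forall m, m <= k -> f (fgen m) = g (fgen m)) -> f =1 g.
Proof.
move=> fM gM fg; apply: pres_hom_ext => // m; have := fg m (ltn_ord m).
by rewrite /fgen totE.
Qed.

Lemma artin_stepK f i b : artin_step (artin_step f (i, b)) (i, ~~ b) = f.
Proof.
move: f; apply: (@free_hom_ext (fun f => artin_step (artin_step f (i, b)) (i, ~~ b)) id) => //.
  by move=> f g /=; rewrite !artin_stepM.
move=> m mk; have ik := ltn_ord i.
rewrite artin_step_gen // /artin_gen.
have [->|mi] := eqVneq m i; [|have [->|mi1] := eqVneq m i.+1].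
- case: b; rewrite /= ?artin_stepM ?(morphgV (artin_stepM _)) !artin_step_gen //=; try lia.
    by rewrite !eqxx gtn_eqF // !eqxx.
  by rewrite !eqxx gtn_eqF // !mulgA mulgV mul1g mulgK.
- case: b; rewrite /= ?artin_stepM ?(morphgV (artin_stepM _)) !artin_step_gen //=; try lia.
    by rewrite !eqxx gtn_eqF // !mulgA mulVg mul1g mulgVK.
  by rewrite !eqxx.
- by case: b; rewrite artin_step_gen //= (negbTE mi) (negbTE mi1).
Qed.

Lemma artin_word_rel u v : @braid_rel Cplane k.+1 u v ->
  forall f, artin_word f u = artin_word f v.
Proof.
have sgen (i : 'I_k) m : m <= k -> artin_step (fgen m) (i, false) = artin_gen (i, false) m.
  exact: artin_step_gen.
have sV l x : artin_step x^-1 l = (artin_step x l)^-1 := morphgV (artin_stepM l) x.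
case=> // i j ij; apply: free_hom_ext; try exact: artin_wordM; move=> m mk;
  have ik := ltn_ord i; have jk := ltn_ord j; have ik' := ltnW ik;
  have jk' := ltnW jk; rewrite /artin_word /=.
- have E : ((i == j :> nat) = false) * ((i == j.+1 :> nat) = false) *
     ((i.+1 == j :> nat) = false) * ((i.+1 == j.+1 :> nat) = false) *
     ((j == i :> nat) = false) * ((j == i.+1 :> nat) = false) *
     ((j.+1 == i :> nat) = false) * ((j.+1 == i.+1 :> nat) = false) *
     ((i.+1 == i :> nat) = false) * ((j.+1 == j :> nat) = false).
    by do !split; apply/eqP; lia.
  rewrite !sgen // /artin_gen.
  have [M|mi] := eqVneq m i; first by rewrite ?M !E !artin_stepM !sV !sgen // /artin_gen !E !eqxx.
  have [M|mi1] := eqVneq m i.+1; first by rewrite ?M !E !sgen // /artin_gen !E !eqxx.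
  have [M|mj] := eqVneq m j; first by rewrite ?M !artin_stepM !sV !sgen // /artin_gen !E !eqxx.
  have [M|mj1] := eqVneq m j.+1; first by rewrite ?M !sgen // /artin_gen !E !eqxx.
  by rewrite !sgen // /artin_gen !(negbTE mi, negbTE mi1, negbTE mj, negbTE mj1).
- rewrite ij in jk jk' *.
  have E (a : nat) : ((a == a.+1) = false) * ((a.+1 == a) = false) *
     ((a == a.+2) = false) * ((a.+2 == a) = false) * ((a == a) = true).
    by do !split; apply/eqP; lia.
  rewrite !sgen // /artin_gen ij.
  have [M|mi] := eqVneq m i.
    rewrite ?M ?E !artin_stepM !sV !sgen // /artin_gen ij !E.
    by rewrite !artin_stepM !sV !sgen // /artin_gen ij !E !gnorm.
  have [M|mi1] := eqVneq m i.+1.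
    rewrite ?M ?E !artin_stepM !sV !sgen // /artin_gen ij !E.
    by rewrite ?artin_stepM ?sV !sgen // /artin_gen ij !E ?gnorm.
  have [M|mi2] := eqVneq m i.+2.
    by rewrite ?M ?E !sgen // /artin_gen ij !E !sgen // /artin_gen ij !E.
  by rewrite !sgen // /artin_gen ij !(negbTE mi, negbTE mi1, negbTE mi2) !sgen //
    /artin_gen ij !(negbTE mi, negbTE mi1, negbTE mi2).
Qed.

Definition artin (f : F) (b : B) : F := artin_word f (repr b).

Lemma artin_pi f u : artin f (\pi_B u) = artin_word f u.
Proof.
apply: (@pres_act _ _ _ (fun=> True) artin_step _ _ _ _ _ f (pres_repr _ u)) => //.
- by move=> *; apply: artin_stepK.
- by move=> u' v' uv t _; apply: artin_word_rel.
Qed.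

Lemma artinM b : {morph artin ^~ b : f g / f * g}.
Proof. exact: artin_wordM. Qed.

Lemma artin1l b : artin 1 b = 1.
Proof. exact: morphg1 (artinM b). Qed.

Lemma artin_act f b b' : artin f (b * b') = artin (artin f b) b'.
Proof.
by rewrite -[b]reprK -[b']reprK presM !artin_pi /artin_word foldl_cat.
Qed.

Lemma artin1 f : artin f 1 = f.
Proof. by rewrite -[1]/(\pi_B [::]) artin_pi. Qed.

Lemma artin_sigma f i : artin f (sigma Cplane i) = artin_step f (i, false).
Proof. by rewrite -[sigma _ _]/(\pi_B [:: (i, false)]) artin_pi. Qed.

(* The semidirect product of the braid group and the free group it acts on. *)
Definition affine_braid : Type := B * F.
HB.instance Definition _ := Choice.on affine_braid.

Definition affine_mul (x y : affine_braid) : affine_braid :=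
  (x.1 * y.1, artin x.2 y.1 * y.2).
Definition affine_inv (x : affine_braid) : affine_braid :=
  (x.1^-1, (artin x.2 x.1^-1)^-1).

Lemma affine_mulA : associative affine_mul.
Proof. by move=> x y z; rewrite /affine_mul /= artinM artin_act !mulgA. Qed.
Lemma affine_mul1 : left_id (1, 1) affine_mul.
Proof. by case=> b f; rewrite /affine_mul /= artin1l !mul1g. Qed.
Lemma affine_mulr1 : right_id (1, 1) affine_mul.
Proof. by case=> b f; rewrite /affine_mul /= artin1 !mulg1. Qed.
Lemma affine_mulV : left_inverse (1, 1) affine_inv affine_mul.
Proof.
case=> b f; rewrite /affine_mul /affine_inv /= mulVg (morphgV (artinM _)).
by rewrite -artin_act mulVg artin1 mulVg.
Qed.
Lemma affine_mulrV : right_inverse (1, 1) affine_inv affine_mul.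
Proof. by case=> b f; rewrite /affine_mul /affine_inv /= !mulgV. Qed.

HB.instance Definition _ := isGroup.Build affine_braid
  affine_mulA affine_mul1 affine_mulr1 affine_mulV affine_mulrV.

Definition aff_s (i : nat) : affine_braid := (sg Cplane k.+1 i, 1).
Definition aff_x (i : nat) : affine_braid := (1, fgen i).

Lemma aff_mulE (x y : affine_braid) : x * y = (x.1 * y.1, artin x.2 y.1 * y.2).
Proof. by []. Qed.

Lemma aff_s_braid : braid_seq k aff_s.
Proof.
have [far adj] := sg_braid Cplane k.+1.
split=> [i j ij|i ik]; rewrite /commute !aff_mulE /= ?mulg1 !artin1l ?mulg1.
  by rewrite far.
by rewrite adj.
Qed.

Lemma aff_comb : comb k aff_s aff_x.
Proof.
split=> [m i mk ik im im1|i ik|i ik]; rewrite /commute !aff_mulE /= ?artin1l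
  ?mulg1 ?mul1g ?artin1.
- rewrite /sg totEP artin_sigma artin_step_gen //=.
  by rewrite (negbTE im) (negbTE im1).
- rewrite /sg totEP artin_sigma artin_step_gen //=.
  by rewrite gtn_eqF // eqxx.
- rewrite /sg totEP artin_sigma artin_stepM !artin_step_gen //=; last by lia.
  by rewrite !eqxx gtn_eqF // mulgVK.
Qed.

End ArtinAction.

Section Embed.
Variables (X : surface) (k : nat).
Local Notation B := (braid_group Cplane k.+1).
Local Notation H := (braid_group X k.+2).
Local Notation t := (sg X k.+2).

Lemma sg_braidS : braid_seq k.+1 t. Proof. exact: sg_braid. Qed.

Lemma embed_rel u v : @braid_rel Cplane k.+1 u v ->
  word_eval (fun i : 'I_k => t i) u = word_eval (fun i : 'I_k => t i) v.
Proof.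
apply: (@braid_rel_Cplane k.+1); exact: braid_seq_le (leqnSn k) sg_braidS.
Qed.

Definition embed : B -> H := pres_lift (fun i : 'I_k => t i).

Lemma embedM : {morph embed : x y / x * y}.
Proof. exact: pres_liftM embed_rel. Qed.

Lemma embed_sg i : i < k -> embed (sg Cplane k.+1 i) = t i.
Proof. by move=> ik; rewrite {1}/sg totEP /embed (pres_lift_gen embed_rel). Qed.

Lemma braid_perm_sg i (o : 'I_k.+2) : i < k.+1 ->
  braid_perm (t i) o = pos_step o i :> nat.
Proof. by move=> ik; rewrite /sg totEP braid_perm_sigma adj_tpermE. Qed.

Lemma embed_perm u (o : 'I_k.+2) :
  braid_perm (embed (\pi u)) o = foldl pos_step o (map fst (map (@nat_letter _) u)) :> nat.
Proof.
rewrite /embed (pres_liftE embed_rel).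
elim: u o => [|[i b] u IHu] o; first by rewrite word_eval_nil (morphg1 (@braid_permM _ _)) perm1.
have ik : i < k.+1 := ltnW (ltn_ord i).
have tV : (braid_perm (t i))^-1 = braid_perm (t i).
  by rewrite /sg totEP braid_perm_sigma /adj_tperm tpermV.
rewrite word_eval_cons braid_permM permM IHu /=.
by case: b; rewrite ?(morphgV (@braid_permM _ _)) ?tV braid_perm_sg.
Qed.

Lemma embed_pure b : braid_perm (embed b) = 1 -> pure_braids Cplane k.+1 b.
Proof.
move=> b1; apply/pure_braidP=> p pk.
have pk2 : p < k.+2 by apply: ltnW.
have := embed_perm (repr b) (Ordinal pk2).
by rewrite reprK b1 perm1.
Qed.

Lemma loop_pure i : i <= k -> braid_perm (loop_elt k t i) = 1.
Proof.
move=> ik; rewrite /loop_elt (subSn ik) desc_recl -mulgA.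
rewrite !braid_permM (morphgV (@braid_permM _ _)) /sg (totEP _ (_ : i < k.+1)).
by rewrite braid_perm_sigma -!mulgA (mulgA (adj_tperm _)) adj_tpermK mul1g mulgV.
Qed.

End Embed.

Section LastStrand.
Variables (X : surface) (k : nat).
Local Notation H := (braid_group X k.+2).
Local Notation t := (sg X k.+2).
Local Notation word := (seq ('I_k.+1 * bool)).

Definition coset_word (G : groupType) (s x : nat -> G) (y : G * nat) (u : word) :=
  foldl (fun y l => coset_step s x y (nat_letter l)) y u.

Lemma coset_wordE (G : groupType) (s x : nat -> G) y u :
  coset_word s x y u = foldl (coset_step s x) y (map (@nat_letter _) u).
Proof. by elim: u y => //= l u IHu y; rewrite IHu. Qed.

(** Started at [(1, k.+1)], whose representative is the empty product, this writes a pure braid as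
    the image under [e] of the element reached. It concerns words, so it also serves with [embed]
    for the sphere, where the action on plane braids need not respect the sphere relation. *)
Lemma coset_word_eval (G : groupType) (s x : nat -> G) (e : G -> H) :
  {morph e : g h / g * h} -> (forall i, i < k -> e (s i) = t i) ->
  (forall i, i <= k -> e (x i) = loop_elt k t i) ->
  forall y u, y.2 <= k.+1 ->
  let z := coset_word s x y u in
  e z.1 * desc t z.2 (k.+1 - z.2) = e y.1 * desc t y.2 (k.+1 - y.2) * \pi_H u.
Proof.
move=> eM es ex y u; rewrite -pres_word.
elim: u y => [|[i b] u IHu] y yk /=; first by rewrite word_eval_nil mulg1.
have ik : i <= k by rewrite -ltnS ltn_ord.
rewrite (IHu (coset_step s x y (nat_letter (i, b)))); last exact: coset_step_dom.
rewrite (coset_step_eval eM (sg_braidS X k) es ex) //.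
rewrite word_eval_cons mulgA /=; congr (_ * _ * _).
by rewrite /sg totE; case: b.
Qed.

Section Hom.
Variables (G : groupType) (s x : nat -> G).
Hypotheses (act_rel : forall u v, @braid_rel X k.+2 u v -> forall y,
  y.2 <= k.+1 -> coset_word s x y u = coset_word s x y v).

Definition last_strand (b : H) : G := (coset_word s x (1, k.+1) (repr b)).1.

Lemma coset_word_eq u v y : pres_eq (@braid_rel X k.+2) u v -> y.2 <= k.+1 ->
  coset_word s x y u = coset_word s x y v.
Proof.
apply: (@pres_act _ _ _ (fun y => y.2 <= k.+1)) => //.
- by move=> z [i b] zk; apply: coset_step_dom => //; rewrite -ltnS ltn_ord.
- by move=> z i b zk; apply: (coset_stepK s x z i b).
Qed.

Lemma pure_last (b : H) : pure_braids X k.+2 b ->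
  (coset_word s x (1, k.+1) (repr b)).2 = k.+1.
Proof. by move/pure_braidP=> bp; rewrite coset_wordE coset_act_pos bp. Qed.

Lemma last_strandM b b' : pure_braids X k.+2 b ->
  last_strand (b * b') = last_strand b * last_strand b'.
Proof.
move=> bp; rewrite /last_strand.
have -> : coset_word s x (1, k.+1) (repr (b * b')) =
    coset_word s x (1, k.+1) (repr b ++ repr b').
  by apply: coset_word_eq => //; apply: pres_repr.
rewrite {1}/coset_word foldl_cat -!/(coset_word _ _ _ _).
rewrite [X in coset_word _ _ X (repr b')]surjective_pairing.
by rewrite pure_last // -[X in (X, _)]mulg1 coset_wordE coset_actM -coset_wordE.
Qed.

End Hom.
End LastStrand.

Section Plane.
Variable k : nat.
Local Notation B := (braid_group Cplane k.+1).
Local Notation F := (free_group 'I_k.+1).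
Local Notation H := (braid_group Cplane k.+2).
Local Notation t := (sg Cplane k.+2).
Local Notation s := (@aff_s k).
Local Notation x := (@aff_x k).

Lemma plane_act_rel u v : @braid_rel Cplane k.+2 u v -> forall y,
  y.2 <= k.+1 -> coset_word s x y u = coset_word s x y v.
Proof.
case=> // i j ij [g p] pk; rewrite !coset_wordE.
  by apply: (coset_far (aff_s_braid k) (aff_comb k)) => //; rewrite -ltnS ltn_ord.
rewrite /nat_letter /= ij.
by apply: (coset_adj (aff_s_braid k) (aff_comb k)) => //; rewrite -ltnS -ij ltn_ord.
Qed.

Definition loops : F -> H := pres_lift (fun i : 'I_k.+1 => loop_elt k t i).

Lemma loopsM : {morph loops : f g / f * g}.
Proof. exact: pres_liftM. Qed.

Lemma loops_gen i : i <= k -> loops (fgen k i) = loop_elt k t i.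
Proof. by move=> ik; rewrite /loops /fgen totEP pres_lift_gen. Qed.

Lemma loops_pure f : braid_perm (loops f) = 1.
Proof.
move: f; apply: pres_subgroup => [|i].
  split=> [|f g|f]; rewrite ?(morphg1 loopsM) ?loopsM ?(morphgV loopsM).
  - exact: (morphg1 (@braid_permM _ _)).
  - by rewrite braid_permM => -> ->; rewrite mulg1.
  - by rewrite (morphgV (@braid_permM _ _)) => ->; rewrite invg1.
by rewrite /loops pres_lift_gen //; apply: loop_pure; rewrite -ltnS ltn_ord.
Qed.

Lemma loops_artin f b : loops f * embed Cplane b = embed Cplane b * loops (artin f b).
Proof.
have [c1 c2 c3] := loop_comb (sg_braidS Cplane k).
move: b f; apply: pres_subgroup => [|i].
  split=> [f|b b' Hb Hb' f|b Hb f].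
  - by rewrite (morphg1 (@embedM Cplane k)) artin1 mulg1 mul1g.
  - by rewrite embedM artin_act mulgA Hb -mulgA Hb' mulgA.
  - rewrite (morphgV (@embedM Cplane k)); apply: (@mulgI _ (embed Cplane b)).
    have := Hb (artin f b^-1); rewrite -artin_act mulVg artin1 => E.
    by rewrite mulgA -E mulgK mulVKg.
have ik := ltn_ord i; have ik' := ltnW ik.
rewrite -[pres_gen _ i]/(sigma Cplane i) => f; rewrite artin_sigma.
have -> : embed Cplane (sigma Cplane i) = t i.
  by rewrite -embed_sg // /sg totE.
apply: (@mulgI _ (t i)^-1); rewrite mulKg.
move: f; apply: pres_hom_ext.
- by move=> f g; rewrite loopsM -!mulgA (mulgA (t i) _ (_ * _)) mulgV mul1g.
- by move=> f g; rewrite artin_stepM loopsM.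
move=> m; have mk : m <= k by rewrite -ltnS ltn_ord.
have -> : pres_gen (@free_rel _) m = fgen k m by rewrite /fgen totE.
rewrite artin_step_gen // loops_gen //= ; apply: (@mulgI _ (t i)); rewrite mulVKg.
have [->|mi] := eqVneq (m : nat) i; [|have [->|mi1] := eqVneq (m : nat) i.+1].
- rewrite !loopsM (morphgV loopsM) !loops_gen //.
  move: (loop_elt k t) c2 c3 => A c2 c3.
  by rewrite mulgA c3 // -(mulgA (A i)) -c2 // !mulgA mulgK.
- by rewrite loops_gen // c2.
- by rewrite loops_gen // c1.
Qed.

Definition push (y : affine_braid k) : H := embed Cplane y.1 * loops y.2.

Lemma pushM : {morph push : y z / y * z}.
Proof.
case=> b f [b' f']; rewrite /push /= embedM loopsM -!mulgA; congr (_ * _).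
by rewrite !mulgA loops_artin.
Qed.

Lemma plane_step : no_perfect (pure_braids Cplane k.+1) ->
  no_perfect (pure_braids Cplane k.+2).
Proof.
move=> nB P pP PK.
pose h := @last_strand Cplane k _ s x.
have hM y z : P y -> P z -> h (y * z) = h y * h z.
  by move=> /PK Ky _; apply: last_strandM plane_act_rel _ _ Ky.
have hE y : P y -> y = push (h y).
  move=> /PK Ky.
  have := @coset_word_eval Cplane k _ s x push pushM _ _ (1, k.+1) (repr y) (leqnn _).
  rewrite /= reprK pure_last // subnn /= !mulg1 (morphg1 pushM) mul1g => -> //.
  - by move=> i ik; rewrite /push /= embed_sg // (morphg1 loopsM) mulg1.
  - by move=> i ik; rewrite /push /= loops_gen // (morphg1 (@embedM Cplane k)) mul1g.
have h1 y : P y -> (h y).1 = 1.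
  apply: (no_perfect_image pP _ _ nB (f := fun y => (h y).1)) => [u v Pu Pv|u Pu].
    by rewrite hM.
  apply: (@embed_pure Cplane); have := PK u Pu; rewrite {1}(hE u Pu) /pure_braids /=.
  by rewrite /push braid_permM loops_pure mulg1.
(* The projection to the free factor is twisted by Artin's action, and becomes multiplicative on [P]
   because the braid components are trivial by [h1]. *)
have h2 y : P y -> (h y).2 = 1.
  apply: (no_perfect_image pP _ _ (@free_no_perfect _) (f := fun y => (h y).2)) => // u v Pu Pv.
  by rewrite hM // [LHS]/= h1 // artin1.
move=> y Py; rewrite (hE y Py) /push h1 // h2 //.
by rewrite (morphg1 (@embedM Cplane k)) (morphg1 loopsM) mulg1.
Qed.

End Plane.

Theorem plane_no_perfect k : no_perfect (pure_braids Cplane k.+1).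
Proof.
elim: k => [|k IHk]; last exact: plane_step.
move=> P _ _ x _; rewrite -[x]reprK; case: (repr x) => [//|[[i il] b] u]; by [].
Qed.

(** * Combing sphere braids *)

Fixpoint asc (G : groupType) (s : nat -> G) (j d : nat) : G :=
  if d is d'.+1 then asc s j d' * s (j + d') else 1.

Section Asc.
Variables (G : groupType) (s : nat -> G).

Lemma asc_desc j d : asc s j d = (desc (fun i => (s i)^-1) j d)^-1.
Proof. by elim: d => [|d IHd] /=; rewrite ?invg1 // invgM invgK IHd. Qed.

Lemma asc_add j d e : asc s j (d + e) = asc s j d * asc s (j + d) e.
Proof.
elim: e => [|e IHe]; first by rewrite addn0 mulg1.
by rewrite addnS /= IHe mulgA addnA.
Qed.

Lemma asc_recl j d : asc s j d.+1 = s j * asc s j.+1 d.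
Proof. by rewrite -add1n asc_add /= mul1g addn0 addn1. Qed.

Lemma asc_commute g j d :
  (forall i, j <= i < j + d -> commute g (s i)) -> commute g (asc s j d).
Proof.
elim: d => [|d IHd] cg /=; first exact: commute1.
by apply: commuteM; [apply: IHd => i ij; apply: cg; lia | apply: cg; lia].
Qed.

Lemma morph_asc (H : groupType) (f : G -> H) j d : {morph f : x y / x * y} ->
  f (asc s j d) = asc (f \o s) j d.
Proof. by move=> fM; elim: d => [|d IHd] /=; rewrite ?morphg1 // fM IHd. Qed.

Lemma morph_desc (H : groupType) (f : G -> H) j d : {morph f : x y / x * y} ->
  f (desc s j d) = desc (f \o s) j d.
Proof. by move=> fM; elim: d => [|d IHd] /=; rewrite ?morphg1 // fM IHd. Qed.

Lemma eq_asc s' j d : (forall i, j <= i < j + d -> s i = s' i) ->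
  asc s j d = asc s' j d.
Proof.
elim: d => //= d IHd ss; rewrite IHd => [|i ij]; last by apply: ss; lia.
by rewrite ss //; lia.
Qed.

Lemma eq_desc s' j d : (forall i, j <= i < j + d -> s i = s' i) ->
  desc s j d = desc s' j d.
Proof.
elim: d => //= d IHd ss; rewrite IHd => [|i ij]; last by apply: ss; lia.
by rewrite ss //; lia.
Qed.

End Asc.

Section AscBraid.
Variables (G : groupType) (s : nat -> G) (k : nat).
Hypothesis sb : braid_seq k s.

Lemma asc_conj i j d : j <= i -> i.+1 < j + d -> j + d <= k ->
  s i.+1 * asc s j d = asc s j d * s i.
Proof.
move=> ji id jk; have := desc_conj (braid_seqV sb) ji id jk.
by move/(congr1 (@inv G)); rewrite !invgM !invgK asc_desc.
Qed.

Lemma asc_far i j d : i < k -> j + d <= k -> i.+1 < j \/ j + d < i ->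
  commute (s i) (asc s j d).
Proof. by move=> ik jk ij; apply: asc_commute => m jm; apply: (braid_comm sb); lia. Qed.

Lemma comb_prod x m : comb k s x -> m < k -> commute (s m) (asc x 0 k.+1).
Proof.
move=> [c1 _ c3] mk.
(* The pair [x m * x m.+1] is isolated: [s m] commutes with it and with every other factor. *)
have -> : k.+1 = m + 2 + (k.-1 - m) by lia.
rewrite !asc_add [asc x (0 + m) 2]/= addn0 addn1 mul1g !add0n.
apply: commuteM; first apply: commuteM; last 1 first.
- by apply: asc_commute => i ij; apply: c1 => //; lia.
- by apply: asc_commute => i ij; apply: c1 => //; lia.
- exact: c3.
Qed.

End AscBraid.

(* The last strand of a sphere braid goes around the strand [j] as the strand
   [j] goes around all the others, in the opposite direction. *)
Definition sphere_loop (G : groupType) (k : nat) (s : nat -> G) (j : nat) : G :=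
  (desc s 0 j * asc s 0 k * desc s j (k - j))^-1.

Section SphereLoop.
Variables (G : groupType) (k : nat) (s : nat -> G).
Hypothesis sb : braid_seq k s.
(** The strand [j] encircles the strands on its left in [Lf j] and those on its right in [Rg j]. *)
Let Lf j := desc s 0 j * asc s 0 j.
Let Rg j := asc s j (k - j) * desc s j (k - j).

Lemma sphere_loopE j : j <= k -> sphere_loop k s j = (Lf j * Rg j)^-1.
Proof.
move=> jk; rewrite /sphere_loop /Lf /Rg -{1}(subnKC jk) asc_add add0n.
by rewrite !mulgA.
Qed.

Lemma LfS j : Lf j.+1 = s j * Lf j * s j.
Proof. by rewrite /Lf /= add0n !mulgA. Qed.

Lemma RgS j : j < k -> Rg j = s j * Rg j.+1 * s j.
Proof. by move=> jk; rewrite /Rg -(subnSK jk) asc_recl desc_recl !mulgA. Qed.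

Lemma Lf_far i j : i < k -> j < i -> commute (s i) (Lf j).
Proof.
by move=> ik ji; apply: commuteM; [apply: (desc_far sb)|apply: (asc_far sb)]; lia.
Qed.

Lemma Rg_far i j : j <= k -> i.+1 < j -> commute (s i) (Rg j).
Proof.
by move=> ik ji; apply: commuteM; [apply: (asc_far sb)|apply: (desc_far sb)]; lia.
Qed.

Lemma Lf_in i j : j <= k -> i.+1 < j -> commute (s i) (Lf j).
Proof.
move=> jk ij; rewrite /Lf /commute mulgA -(desc_conj sb) //.
by rewrite -mulgA (asc_conj sb) // !mulgA.
Qed.

Lemma Rg_in i j : j < i -> i < k -> commute (s i) (Rg j).
Proof.
case: i => // i ji ik; rewrite /Rg /commute mulgA (asc_conj sb); try lia.
by rewrite -mulgA -(desc_conj sb) ?mulgA //; lia.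
Qed.

Lemma sphere_loop_comb : comb k s (sphere_loop k s).
Proof.
have cLR i j : i < j -> j <= k -> commute (Lf i) (Rg j).
  move=> ij jk; apply: commuteM; [apply: asc_commute | apply: desc_commute] => m jm;
  by apply/commute_sym/Lf_far; lia.
split=> [m i mk ik im im1|i ik|i ik].
- rewrite sphere_loopE //; apply: commuteV; have [mi|mi] := ltnP m i.
    by apply: commuteM; [apply: Lf_in | apply: Rg_far]; lia.
  by apply: commuteM; [apply: Lf_far | apply: Rg_in]; lia.
- rewrite !sphere_loopE ?(ltnW ik) // LfS (RgS ik) !invgM.
  by rewrite !mulgA mulgV mul1g -!mulgA mulVg mulg1.
rewrite !sphere_loopE ?(ltnW ik) // -invgM; apply: commuteV.
rewrite LfS (RgS ik); set L := Lf i; set R := Rg i.+1; set c := s i.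
have LR : L * R = R * L by apply: cLR.
(* The commutation of [Lf i] with [Lf i.+1 = c * L * c] is a braid relation of type B between [c]
   and [L]; the same holds for [R]. Together with [LR] they give [E], which multiplied by [c] on
   both sides is the goal. *)
have cL : c * L * c * L = L * c * L * c.
  have : commute L (Lf i.+1).
    apply: commute_sym; apply: commuteM; [apply: desc_commute | apply: asc_commute] => m jm;
    by apply/commute_sym/Lf_in; lia.
  by rewrite LfS -/c -/L /commute !mulgA.
have cR : c * R * c * R = R * c * R * c.
  have : commute R (Rg i).
    apply: commute_sym; apply: commuteM; [apply: asc_commute | apply: desc_commute] => m jm;
    by apply/commute_sym/Rg_in; lia.
  by rewrite (RgS ik) -/c -/R /commute !mulgA.
clearbody c L R.
have cR' z : z * c * R * c * R = z * R * c * R * c.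
  by have := congr1 (mulg z) cR; rewrite !mulgA.
have E : c * L * c * R * L * c * R = L * c * R * L * c * R * c.
  by rewrite -(mulgA _ R L) -LR !mulgA cL cR' -(mulgA _ L R) LR !mulgA.
by have := congr1 (fun z => c * z * c) E; rewrite /commute !mulgA.
Qed.

End SphereLoop.

Section SphereWord.
Variables (G : groupType) (s x : nat -> G).
Local Notation act := (foldl (coset_step s x)).
Local Notation pos_word := (map (fun i => (i, false))).

Lemma iotaSr m d : iota m d.+1 = rcons (iota m d) (m + d).
Proof. by rewrite -addn1 iotaD cats1. Qed.

Lemma act_lt m p g : m < p -> act (g, p) (pos_word (iota 0 m)) = (g * asc s 0 m, p).
Proof.
elim: m => [|m IHm] mp; first by rewrite mulg1.
by rewrite iotaSr map_rcons foldl_rcons IHm ?(ltnW mp) // step_lt // -mulgA.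
Qed.

Lemma act_up m g : act (g, 0) (pos_word (iota 0 m)) = (g * asc x 0 m, m).
Proof.
elim: m => [|m IHm]; first by rewrite mulg1.
by rewrite iotaSr map_rcons foldl_rcons IHm step_eq -mulgA.
Qed.

Lemma act_gt j d g : act (g, j) (pos_word (iota j.+1 d)) = (g * asc s j d, j).
Proof.
elim: d => [|d IHd]; first by rewrite mulg1.
by rewrite iotaSr map_rcons foldl_rcons IHd step_gt ?leq_addr // -mulgA.
Qed.

Lemma act_lt_rev m p g : m < p ->
  act (g, p) (pos_word (rev (iota 0 m))) = (g * desc s 0 m, p).
Proof.
elim: m g => [|m IHm] g mp; first by rewrite mulg1.
by rewrite iotaSr rev_rcons map_cons /foldl -/(foldl _) step_lt // IHm ?(ltnW mp) // -mulgA.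
Qed.

Lemma act_down m g : act (g, m) (pos_word (rev (iota 0 m))) = (g, 0).
Proof.
elim: m g => [//|m IHm] g.
by rewrite iotaSr rev_rcons map_cons /foldl -/(foldl _) step_pred IHm.
Qed.

Lemma act_gt_rev j d g :
  act (g, j) (pos_word (rev (iota j.+1 d))) = (g * desc s j d, j).
Proof.
elim: d g => [|d IHd] g; first by rewrite mulg1.
rewrite iotaSr rev_rcons map_cons /foldl -/(foldl _) step_gt ?leq_addr //.
by rewrite IHd -mulgA.
Qed.

Definition sphere_word k := iota 0 k.+1 ++ rev (iota 0 k.+1).

Lemma act_sphere0 k g :
  act (g, 0) (pos_word (sphere_word k)) = (g * asc x 0 k.+1, 0).
Proof. by rewrite map_cat foldl_cat act_up act_down. Qed.

(** This is the origin of [sphere_loop]: requiring the sphere word to fix [g] determines [x j]. At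
    position 0 the product of all the [x j] is left over, and it has to be killed by a quotient. *)
Lemma act_sphere k j g : j <= k ->
  act (g, j.+1) (pos_word (sphere_word k)) =
  (g * asc s 0 k * desc s j (k - j) * x j * desc s 0 j, j.+1).
Proof.
move=> jk; have -> : sphere_word k =
    (iota 0 j ++ j :: iota j.+1 (k - j)) ++ rev (iota 0 j ++ j :: iota j.+1 (k - j)).
  have -> : j :: iota j.+1 (k - j) = iota (0 + j) (k.+1 - j) by rewrite subSn.
  by rewrite -iotaD subnKC // leqW.
rewrite rev_cat rev_cons -cats1 !map_cat !foldl_cat act_lt //.
rewrite map_cons /foldl -/(foldl _) step_pred act_gt act_gt_rev.
have act1 y i : act y (pos_word [:: i]) = coset_step s x y (i, false) by [].
rewrite act1 step_eq act_lt_rev // -{3}(subnKC jk) asc_add add0n !mulgA; congr (_, _).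
Qed.

End SphereWord.

Lemma coset_word_map (G G' : groupType) (f : G -> G') (s x : nat -> G) k :
  {morph f : a b / a * b} -> forall z (u : seq ('I_k.+1 * bool)),
  coset_word (f \o s) (f \o x) (f z.1, z.2) u =
  (f (coset_word s x z u).1, (coset_word s x z u).2).
Proof.
move=> fM z u; elim: u z => [//|[i b] u IHu] z.
have cons (K : groupType) (s' x' : nat -> K) y :
  coset_word s' x' y ((i, b) :: u) =
  coset_word s' x' (coset_step s' x' y (nat_letter (i, b))) u by [].
rewrite !cons -IHu; congr coset_word; case: z => g p /=.
by do ?case: ifP => _; rewrite /= ?fM ?(morphgV fM) //; case: b {cons};
  rewrite /= ?fM ?(morphgV fM).
Qed.

Section Sphere.
Variable k : nat.
Local Notation B := (braid_group Cplane k.+1).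
Local Notation H := (braid_group CP1 k.+2).
Local Notation t := (sg CP1 k.+2).
Local Notation s0 := (sg Cplane k.+1).
Local Notation x0 := (sphere_loop k s0).

(** This is the inverse of the square of the full twist. *)
Definition sphere_total : B := asc x0 0 k.+1.

Lemma sphere_total_central b : commute b sphere_total.
Proof.
have cb := sphere_loop_comb (sg_braid Cplane k.+1).
move: b; apply: pres_subgroup => [|i].
  split=> [|x y cx cy|x cx].
  - exact/commute_sym/commute1.
  - by apply/commute_sym/commuteM; apply/commute_sym.
  - by apply/commute_sym/commuteV/commute_sym.
have -> : pres_gen (@braid_rel Cplane k.+1) i = s0 i by rewrite /sg totE.
exact: (comb_prod cb).
Qed.

(* The stabilizer of the last strand in the sphere braid group is the quotient
   of the plane braid group by the central element [sphere_total]. *)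
Definition sphere_rel (u v : seq ('I_k * bool)) :=
  @braid_rel Cplane k.+1 u v \/ u = repr sphere_total /\ v = [::].

Local Notation G := (presented sphere_rel).

Definition stab_quot : B -> G := pres_lift (pres_gen sphere_rel).

Lemma stab_quot_rel u v : @braid_rel Cplane k.+1 u v ->
  word_eval (pres_gen sphere_rel) u = word_eval (pres_gen sphere_rel) v.
Proof. by move=> uv; apply: pres_gen_rel; left. Qed.

Lemma stab_quotM : {morph stab_quot : x y / x * y}.
Proof. exact: pres_liftM stab_quot_rel. Qed.

Lemma stab_quot_pi u : stab_quot (\pi u) = \pi_G u.
Proof. by rewrite /stab_quot (pres_liftE stab_quot_rel) pres_word. Qed.

Lemma stab_quot_total : stab_quot sphere_total = 1.
Proof.
rewrite -[sphere_total]reprK stab_quot_pi -[1]/(\pi_G [::]).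
by apply/pres_piP/pres_rel; right.
Qed.

(** The only added relator is central, so induction on a derivation of an equality of words shows
    that the two sides differ by a central plane braid. *)
Lemma stab_quot_ker b : stab_quot b = 1 -> forall c, commute b c.
Proof.
pose Z (x : B) := forall c, commute x c.
have [Z1 ZM ZV] : is_subgroup Z.
  split=> [c|x y cx cy c|x cx c]; first exact/commute_sym/commute1.
    by apply/commute_sym/commuteM; apply/commute_sym.
  by apply/commute_sym/commuteV/commute_sym.
have pi0 : \pi_B [::] = 1 by [].
have ker u v : pres_eq sphere_rel u v -> Z (\pi_B u * (\pi_B v)^-1).
  elim=> {u v} [u|u v _ IH|u v w _ IHu _ IHv|u u' v v' _ IHu _ IHv|i c|u v [uv|[-> ->]]].
  - by rewrite mulgV.
  - by rewrite -[X in X * _]invgK -invgM; apply: ZV.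
  - by rewrite -[\pi_B u](mulgVK (\pi_B v)) -mulgA; apply: ZM.
  - rewrite -!presM; move: (\pi_B u) (\pi_B u') (\pi_B v) (\pi_B v') IHu IHv.
    move=> a a' c c' Za Zc; rewrite invgM -!mulgA (mulgA c) (Zc a'^-1) mulgA.
    exact: ZM.
  - by rewrite (_ : \pi_B _ = 1) ?mul1g ?invg1 //;
      exact: (pres_piP _ _ _).2 (pres_cancel _ i c).
  - by rewrite (_ : \pi_B u = \pi_B v) ?mulgV //;
      exact: (pres_piP _ _ _).2 (pres_rel uv).
  - rewrite reprK pi0 invg1 mulg1 => c; exact/commute_sym/sphere_total_central.
rewrite -[b]reprK stab_quot_pi -[1]/(\pi_G [::]) => /pres_piP /ker.
by rewrite pi0 invg1 mulg1.
Qed.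

Local Notation s := (stab_quot \o s0).
Local Notation x := (stab_quot \o x0).

Lemma stab_quot_braid : braid_seq k s.
Proof.
have [far adj] := sg_braid Cplane k.+1.
split=> [i j ij|i ik] /=; first by rewrite /commute -!stab_quotM far.
by rewrite -!stab_quotM adj.
Qed.

Lemma stab_quot_comb : comb k s x.
Proof.
have [c1 c2 c3] := sphere_loop_comb (sg_braid Cplane k.+1).
split=> [m i mk ik im im1|i ik|i ik] /=; rewrite /commute -!stab_quotM.
- by rewrite c1.
- by rewrite c2.
- by rewrite c3.
Qed.

Lemma coset_word_sphere (G' : groupType) (s' x' : nat -> G') y :
  coset_word s' x' y [seq (i, false) | i <- enum 'I_k.+1 ++ rev (enum 'I_k.+1)] =
  foldl (coset_step s' x') y [seq (i, false) | i <- sphere_word k].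
Proof.
rewrite coset_wordE; congr foldl; rewrite /sphere_word -val_enum_ord.
by rewrite -map_rev -map_cat -!map_comp.
Qed.

Lemma sphere_act_rel u v : @braid_rel CP1 k.+2 u v -> forall y,
  y.2 <= k.+1 -> coset_word s x y u = coset_word s x y v.
Proof.
case=> [i j ij|i j ij|_] [g p] pk.
- rewrite !coset_wordE; apply: (coset_far stab_quot_braid stab_quot_comb) => //.
  by rewrite -ltnS ltn_ord.
- rewrite !coset_wordE /nat_letter /= ij.
  by apply: (coset_adj stab_quot_braid stab_quot_comb) => //; rewrite -ltnS -ij ltn_ord.
rewrite coset_word_sphere; case: p pk => [|j] jk.
  by rewrite act_sphere0 -morph_asc ?stab_quot_total ?mulg1 //; apply: stab_quotM.
rewrite act_sphere // -(@morph_asc _ s0 _ _ _ _ stab_quotM).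
rewrite -!(@morph_desc _ s0 _ _ _ _ stab_quotM) /=.
rewrite -!mulgA -!stab_quotM /sphere_loop !invgM -!mulgA mulVg mulg1 mulVKg mulgV.
by rewrite (morphg1 stab_quotM) mulg1.
Qed.

(** The sphere word is trivial in [H]. Evaluated from the coset [j.+1], with [H] itself as the
    acting group, it can be solved for the loop. *)
Lemma embed_sphere_loop j : j <= k -> embed CP1 (x0 j) = loop_elt k t j.
Proof.
move=> jk.
pose y0 := (1 : H, j.+1).
have := @coset_word_eval CP1 k H t (loop_elt k t) id _ _ _ y0
  [seq (i, false) | i <- enum 'I_k.+1 ++ rev (enum 'I_k.+1)].
rewrite coset_word_sphere act_sphere // /=.
have -> : \pi_H [seq (i, false) | i <- enum 'I_k.+1 ++ rev (enum 'I_k.+1)] = 1.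
  rewrite -[1]/(\pi_H [::]);
  exact: (pres_piP _ _ _).2 (pres_rel (@braid_rel_sphere CP1 k.+2 (erefl _))).
have {}step : asc t 0 k = embed CP1 (asc s0 0 k).
  rewrite (@morph_asc _ s0 _ _ _ _ (@embedM CP1 k)); apply: eq_asc => i ik.
  by rewrite /= embed_sg //; lia.
have E1 : desc t j (k - j) = embed CP1 (desc s0 j (k - j)).
  rewrite (@morph_desc _ s0 _ _ _ _ (@embedM CP1 k)); apply: eq_desc => i ik.
  by rewrite /= embed_sg //; lia.
have E2 : desc t 0 j = embed CP1 (desc s0 0 j).
  rewrite (@morph_desc _ s0 _ _ _ _ (@embedM CP1 k)); apply: eq_desc => i ik.
  by rewrite /= embed_sg //; lia.
rewrite /sphere_loop (morphgV (@embedM CP1 k)) !embedM -{}E1 -{}E2 -{}step mulg1.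
move: (loop_elt k t j) => l /(_ (fun _ _ => erefl) (fun _ _ => erefl) (fun _ _ => erefl) jk).
move/mulIg; rewrite mul1g => E; apply/esym/(@mulgI _ (asc t 0 k * desc t j (k - j))).
by apply: (@mulIg _ (desc t 0 j)); rewrite E -!mulgA !invgM -!mulgA mulVg mulg1 mulVKg mulgV.
Qed.

(** Triviality of [h] on [P] only puts the plane lifts of [P] into the kernel of [stab_quot]. That
    kernel is central, so [P] is commutative, and being perfect it is trivial. *)
Lemma sphere_step : no_perfect (pure_braids Cplane k.+1) ->
  no_perfect (pure_braids CP1 k.+2).
Proof.
move=> nB P pP PK.
pose h := @last_strand CP1 k _ s x.
have hM y z : P y -> P z -> h (y * z) = h y * h z.
  by move=> /PK Ky _; apply: last_strandM sphere_act_rel _ _ Ky.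
have hE y : P y -> exists w, [/\ embed CP1 w = y, stab_quot w = h y & pure_braids Cplane k.+1 w].
  move=> Py; have Ky := PK y Py.
  exists (coset_word s0 x0 (1, k.+1) (repr y)).1.
  have E : embed CP1 (coset_word s0 x0 (1, k.+1) (repr y)).1 = y.
    have := @coset_word_eval CP1 k _ s0 x0 (@embed CP1 k) (@embedM CP1 k) _ _
      (1, k.+1) (repr y) (leqnn _).
    rewrite /= reprK pure_last // subnn /= !mulg1 (morphg1 (@embedM CP1 k)) mul1g => -> //.
    - by move=> i ik; rewrite embed_sg.
    - by move=> i ik; rewrite embed_sphere_loop.
  split=> //; last by apply: (@embed_pure CP1); rewrite E.
  rewrite /h /last_strand.
  have := coset_word_map s0 x0 stab_quotM (1, k.+1) (repr y); rewrite /= (morphg1 stab_quotM).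
  by move=> Ey; rewrite Ey.
have h1 : forall y, P y -> h y = 1.
  apply: (no_perfect_image pP hM _ (no_perfect_central stab_quotM _ stab_quot_ker _ nB)
    (K := fun g => exists2 w, pure_braids Cplane k.+1 w & stab_quot w = g)) => //.
  - by move=> u /hE [w [_ Ew Kw]]; exists w.
  - split; rewrite /pure_braids /=; first exact: (morphg1 (@braid_permM _ _)).
      by move=> u v Eu Ev; rewrite braid_permM Eu Ev mulg1.
    by move=> u Eu; rewrite (morphgV (@braid_permM _ _)) Eu invg1.
apply: (perfect_abelian pP) => a b Pa Pb.
have [[wa [Ea qa _]] [wb [Eb _ _]]] := (hE a Pa, hE b Pb).
have wa1 : stab_quot wa = 1 by rewrite qa h1.
by rewrite /commute -Ea -Eb -!(@embedM CP1 k) (stab_quot_ker wa1 wb).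
Qed.

End Sphere.

Theorem pure_no_perfect X n : 1 < n -> no_perfect (pure_braids X n).
Proof.
case: n => [|[|k]] // _; case: X; first exact: plane_no_perfect.
exact/sphere_step/plane_no_perfect.
Qed.

(** * Half twists in non-cyclic images *)

Section BraidCommute.
Variables (G : groupType) (k : nat) (s : nat -> G).
Hypothesis sb : braid_seq k s.

Lemma braid_commute_eq i : i.+1 < k -> commute (s i) (s i.+1) -> s i = s i.+1.
Proof.
move=> ik c; have := sb.2 i ik; by rewrite c => /mulgI.
Qed.

(** As [s i] commutes with [s i.+2], equality of one neighbouring pair makes the other pair commute,
    and commuting neighbours coincide. *)
Lemma braid_eqS i : i.+2 < k -> (s i = s i.+1) <-> (s i.+1 = s i.+2).
Proof.
move=> ik; have far : commute (s i) (s i.+2) by apply: (braid_comm sb); lia.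
split=> E; apply: braid_commute_eq; rewrite ?(ltnW ik) //.
  by rewrite -E.
by rewrite E.
Qed.

Lemma braid_eq0 i : i.+1 < k -> s i = s i.+1 -> s 0 = s 1.
Proof.
elim: i => // i IHi ik E; apply: IHi; first exact: ltnW.
exact/braid_eqS.
Qed.

Lemma braid_const : s 0 = s 1 -> forall i, i < k -> s i = s 0.
Proof.
move=> E; elim=> // i IHi ik; rewrite -(IHi (ltnW ik)).
suff -> : s i = s i.+1 by [].
elim: i ik {IHi} => // i IHi ik; apply/(braid_eqS ik); exact: IHi (ltnW ik).
Qed.

Lemma commute_conjg (x y g : G) : commute (x ^ g) y -> commute g y -> commute x y.
Proof.
move=> cxy cgy; apply: (@conjg_inj _ g); rewrite !conjMg.
by have -> : y ^ g = y by apply/conjg_fixP/commgP/commute_sym.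
Qed.

(* The half twist of the strands [i] and [j]. *)
Definition band i j := s i ^ (desc s i.+1 (j - i.+1))^-1.

Hypothesis s01 : s 0 != s 1.

Lemma braid_ncomm i : i.+1 < k -> ~ commute (s i) (s i.+1).
Proof. by move=> ik /(braid_commute_eq ik) /(braid_eq0 ik) /eqP; apply/negP. Qed.

Lemma descK i d e : i + d < k -> e <= d ->
  desc s i d.+1 * desc s i.+1 e = desc s i e * desc s i d.+1.
Proof.
move=> idk; elim: e => [|e IHe] ed; first by rewrite mulg1 mul1g.
rewrite [desc s i.+1 e.+1]/= [desc s i e.+1]/= mulgA addSn (desc_conj sb); try lia.
by rewrite -mulgA IHe ?mulgA // ltnW.
Qed.

Lemma bandE i j : i < j <= k -> band i j = s j.-1 ^ desc s i (j.-1 - i).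
Proof.
case: j => // j /andP[ij jk]; rewrite /band subSS.
have E := @descK i (j - i) (j - i) (_ : i + (j - i) < k) (leqnn _).
rewrite conjgE invgK mulgA conjgE /=.
apply: (@mulgI _ (desc s i (j - i))); apply: (@mulIg _ (desc s i.+1 (j - i))).
rewrite -mulgA mulgVK -[in LHS]desc_recl -E ?subnKC //.
by rewrite mulVKg /= subnKC.
Qed.

(* [band i j] fails to commute with exactly these generators [s m], which makes
   the bands pairwise distinct when there are at least five strands. *)
Definition crossing i j m :=
  if j == i.+1 then (m.+1 == i) || (m == i.+1)
  else [|| m.+1 == i, m == i, m.+1 == j | m == j].

Lemma band_commute i j m : i < j <= k -> m < k -> ~~ crossing i j m ->
  commute (band i j) (s m).
Proof.
move=> /andP[ij jk] mk; rewrite /crossing => N; apply: commute_sym; rewrite /band conjgE invgK.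
have [[mi|mj]|[[im mj]|[E1 E2]]] :
    ((m.+1 < i) \/ (j < m)) \/ ((i < m /\ m.+1 < j) \/ (m = i /\ j = i.+1)).
  by move: N; case: eqP; lia.
- have c := @desc_far _ k s sb m i.+1 (j - i.+1) mk.
  have {}c : commute (s m) (desc s i.+1 (j - i.+1)) by apply: c; lia.
  apply: commuteM => //; apply: commuteM; last exact: commuteV.
  by apply: (braid_comm sb); lia.
- have c := @desc_far _ k s sb m i.+1 (j - i.+1) mk.
  have {}c : commute (s m) (desc s i.+1 (j - i.+1)) by apply: c; lia.
  apply: commuteM => //; apply: commuteM; last exact: commuteV.
  by apply: (braid_comm sb); lia.
- have c : desc s i.+1 (j - i.+1) * s m.+1 = s m * desc s i.+1 (j - i.+1).
    by apply: (desc_conj sb); lia.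
  have far : commute (s m.+1) (s i) by apply: (braid_comm sb); lia.
  rewrite /commute mulgA -c -mulgA (mulgA (s m.+1)) far -!mulgA; congr (_ * (_ * _)).
  by apply: (@mulgI _ (desc s i.+1 (j - i.+1))); rewrite mulgA c mulgK mulVKg.
- by rewrite E1 E2 subnn invg1 mulg1 mul1g.
Qed.

(** Written from a suitable end, the band is a conjugate by elements commuting with [s m];
    [commute_conjg] strips them until two neighbouring generators remain. *)
Lemma band_ncomm i j m : i < j <= k -> m < k -> crossing i j m ->
  ~ commute (band i j) (s m).
Proof.
have up i' j' : i' < j' < k -> ~ commute (band i' j') (s j').
  case: j' => // j' /andP[ij jk]; have ijk : i' < j'.+1 <= k by rewrite ij ltnW.
  rewrite (bandE ijk) => c; apply: (@braid_ncomm j' jk).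
  apply: commute_conjg c _; apply: commute_sym; apply: (desc_far sb) => //=; lia.
have dn i' j' : i'.+1 < j' <= k -> ~ commute (band i'.+1 j') (s i').
  move=> /andP[ij jk] c; apply: (@braid_ncomm i'); first by lia.
  apply: commute_sym; apply: commute_conjg c _.
  apply/commute_sym/commuteV; apply: (desc_far sb) => //=; lia.
move=> /andP[ij jk] mk; rewrite /crossing.
have [ji|ji] := eqVneq j i.+1.
  case/orP=> /eqP E; first by rewrite -E in ij jk *; apply: dn; lia.
  by rewrite E -ji; apply: up; lia.
have {}ij : i.+1 < j by lia.
case/or4P=> /eqP E.
- by rewrite -E in ij jk *; apply: dn; lia.
- rewrite E bandE; last by lia.
  have -> : j.-1 - i = (j.-1 - i.+1).+1 by lia.
  rewrite desc_recl conjgM -bandE; last by lia.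
  by move/commute_conjg => /(_ (commute_refl _)); apply: dn; lia.
- rewrite -E in ij jk *; rewrite /band.
  have -> : m.+1 - i.+1 = (m - i.+1).+1 by lia.
  rewrite /= subnKC; last by lia.
  rewrite invgM conjgM -/(band i m) => /commute_conjg.
  by move/(_ (commute_sym (commuteV (commute_refl _)))); apply: up; lia.
- by rewrite E; apply: up; lia.
Qed.

Lemma crossingP i j m : crossing i j m <->
  (j = i.+1 /\ (m.+1 = i \/ m = i.+1)) \/
  (j <> i.+1 /\ (m.+1 = i \/ m = i \/ m.+1 = j \/ m = j)).
Proof. by rewrite /crossing; case: eqP => ji; lia. Qed.

Lemma band_crossing i j i' j' m : i < j <= k -> i' < j' <= k ->
  band i j = band i' j' -> m < k -> crossing i j m -> crossing i' j' m.
Proof.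
move=> ij ij' E mk C; apply/negPn/negP => N.
by apply: (band_ncomm ij mk C); rewrite E; apply: band_commute.
Qed.

(** Equal bands are crossed by the same generators. On four strands the bands of 0, 1 and of 2, 3
    would both be crossed by [s 1] alone; [s 3] separates them. *)
Lemma band_inj1 i j i' j' : 3 < k -> i < j <= k -> i' < j' <= k ->
  band i j = band i' j' -> i' <= i.
Proof.
move=> k3 ij ij' E; rewrite leqNgt; apply/negP => ii'.
have X m (mk : m < k) := band_crossing ij ij' E mk.
have Y m (mk : m < k) := band_crossing ij' ij (esym E) mk.
have i0 : i = 0.
  case: i ij ii' X {E Y} => // i ij ii' X.
  have /crossingP : crossing i' j' i by apply: X; [|apply/crossingP]; lia.
  lia.
rewrite {}i0 in ij ii' X Y E.
have [j1|j1] := eqVneq j 1%N.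
  have : crossing 0 j i'.-1 by apply: Y; [|apply/crossingP]; lia.
  move/crossingP=> H; have {H} i2 : i' = 2 by lia.
  have [j3|j3] := eqVneq j' 3.
    have /crossingP : crossing 0 j 3 by apply: Y; [|apply/crossingP]; lia.
    lia.
  have /crossingP : crossing 0 j 2 by apply: Y; [|apply/crossingP]; lia.
  lia.
have i1 : i' = 1%N.
  have /crossingP : crossing i' j' 0 by apply: X; [|apply/crossingP]; lia.
  lia.
have [j2|j2] := eqVneq j' 2.
  have /crossingP C2 : crossing 0 j 2 by apply: Y; [|apply/crossingP]; lia.
  have /crossingP C1 : crossing i' j' j.-1 by apply: X; [|apply/crossingP]; lia.
  have j3 : j = 3 by lia.
  have /crossingP : crossing i' j' 3 by apply: X; [|apply/crossingP]; lia.
  lia.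
have /crossingP C1 : crossing 0 j 1 by apply: Y; [|apply/crossingP]; lia.
have j2' : j = 2 by lia.
have /crossingP C3 : crossing 0 j j'.-1 by apply: Y; [|apply/crossingP]; lia.
have j3 : j' = 3 by lia.
have /crossingP : crossing 0 j 3 by apply: Y; [|apply/crossingP]; lia.
lia.
Qed.

Lemma band_inj2 i j j' : i < j <= k -> i < j' <= k ->
  band i j = band i j' -> j' <= j.
Proof.
move=> ij ij' E; rewrite leqNgt; apply/negP => jj'.
have X m (mk : m < k) := band_crossing ij ij' E mk.
have Y m (mk : m < k) := band_crossing ij' ij (esym E) mk.
have [j1|j1] := eqVneq j i.+1.
  have /crossingP : crossing i j i by apply: Y; [|apply/crossingP]; lia.
  lia.
have /crossingP C1 : crossing i j' j by apply: X; [|apply/crossingP]; lia.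
have /crossingP C2 : crossing i j' j.-1 by apply: X; [|apply/crossingP]; lia.
lia.
Qed.

Lemma band_inj i j i' j' : 3 < k -> i < j <= k -> i' < j' <= k ->
  band i j = band i' j' -> i = i' /\ j = j'.
Proof.
move=> k3 ij ij' E.
have Ei : i = i'.
  by apply/eqP; rewrite eqn_leq
    !(@band_inj1 _ _ _ _ _ _ _ E, @band_inj1 _ _ _ _ _ _ _ (esym E)).
rewrite -{}Ei in ij' E *; split=> //.
by apply/eqP; rewrite eqn_leq !(@band_inj2 _ _ _ _ _ E, @band_inj2 _ _ _ _ _ (esym E)).
Qed.

End BraidCommute.

Lemma card_ltn_pairs n : #|[set p : 'I_n * 'I_n | p.1 < p.2]| = 'C(n, 2).
Proof.
rewrite -sum1dep_card -(pair_big_dep xpredT (fun i j : 'I_n => i < j) (fun _ _ => 1%N)) /=.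
rewrite (exchange_big_dep xpredT) //= -bin2_sum big_mkord; apply: eq_bigr => j _.
rewrite sum1_card -[RHS]card_ord.
have /card_imset <- : injective (widen_ord (ltnW (ltn_ord j))).
  by move=> a b /(congr1 val) /= E; apply: val_inj.
apply: eq_card => i; rewrite unfold_in; apply/idP/imsetP => [ij|[a _ ->]] /=.
  by exists (Ordinal ij) => //; apply: val_inj.
exact: ltn_ord.
Qed.

Definition braid_gen (gT : finGroupType) (s : nat -> gT) k :=
  <<[set s (nat_of_ord i) | i : 'I_k]>>.
Canonical braid_gen_group gT s k := Eval hnf in [group of @braid_gen gT s k].

Lemma mem_braid_gen (gT : finGroupType) (s : nat -> gT) k i :
  i < k -> s i \in braid_gen s k.
Proof. by move=> ik; apply: mem_gen; apply/imsetP; exists (Ordinal ik). Qed.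

Lemma braid_gen_sub (gT : finGroupType) (s : nat -> gT) k (G : {group gT}) :
  (forall i, i < k -> s i \in G) -> braid_gen s k \subset G.
Proof.
move=> sG; rewrite gen_subG; apply/subsetP=> _ /imsetP[i _ ->]; exact: sG.
Qed.

Lemma mem_desc (gT : finGroupType) (s : nat -> gT) (G : {group gT}) j d :
  (forall i, j <= i < j + d -> s i \in G) -> desc s j d \in G.
Proof.
elim: d => [|d IHd] sG /=; first exact: group1.
by rewrite groupM ?IHd //= => [|i ij]; apply: sG; lia.
Qed.

Lemma braid_class (gT : finGroupType) (s : nat -> gT) k (G : {group gT}) a d :
  braid_seq k s -> (forall i, a <= i < a + d -> s i \in G) -> a + d <= k ->
  forall i, a <= i < a + d -> s i \in s a ^: G.
Proof.
move=> sb sG adk i /andP[ai id]; rewrite -(subnKC ai).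
have {id} : i - a < d by lia.
elim: (i - a) => [|e IHe] ed; first by rewrite addn0 class_refl.
rewrite -(class_eqP (IHe (ltnW ed))) addnS.
apply/imsetP; exists ((s (a + e) * s (a + e).+1)^-1).
  by rewrite groupV groupM ?sG //; lia.
rewrite conjgE invgK mulgA sb.2; last by lia.
by rewrite -!mulgA invgM mulVKg ?mulgV ?mulg1.
Qed.

(** Bands are kept distinct by the ambient sequence of [k] generators, so even a short block inside
    [G] gives a large class: three generators give six elements. *)
Lemma braid_class_card (gT : finGroupType) (s : nat -> gT) k (G : {group gT}) a d :
  braid_seq k s -> s 0 != s 1%N -> 3 < k -> a + d <= k -> 0 < d ->
  (forall i, a <= i < a + d -> s i \in G) -> ('C(d.+1, 2) <= #|s a ^: G|)%N.
Proof.
move=> sb s01 k3 adk d0 sG.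
pose f (p : 'I_d.+1 * 'I_d.+1) := band s (a + p.1) (a + p.2).
have fb (p : 'I_d.+1 * 'I_d.+1) : p.1 < p.2 -> a + p.1 < a + p.2 <= k.
  by have := ltn_ord p.2; lia.
rewrite -card_ltn_pairs -(card_in_imset (f := f)).
  apply/subset_leq_card/subsetP=> _ /imsetP[[p q]] /[!inE] /= pq ->.
  have qd := ltn_ord q; rewrite -(class_eqP (braid_class sb sG adk (i := a + p) _)); last by lia.
  apply/imsetP; exists (desc s (a + p).+1 (a + q - (a + p).+1))^-1 => //.
  by rewrite groupV mem_desc // => i iq; apply: sG; lia.
move=> [p q] [p' q']; rewrite !inE /= => pq pq'.
move/(band_inj sb s01 k3 (fb (p, q) pq) (fb (p', q') pq')) => /=.
by move=> [/addnI pp /addnI qq]; congr pair; apply: val_inj.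
Qed.

(** * Finite images of the braid group *)

Section Coxeter.
Variable gT : finGroupType.

(** For involutions the loops are trivial, so the union [U] of the [k.+2] cosets is stable under
    right multiplication by the generators; it contains 1, hence the whole group. *)
Lemma coxeter_card k (s : nat -> gT) : braid_seq k s ->
  (forall i, i < k -> s i * s i = 1) -> #|braid_gen s k| <= k.+1`!.
Proof.
elim: k => [|k IHk] sb s2.
  have /subset_leq_card : braid_gen s 0 \subset 1%G by apply: braid_gen_sub.
  by rewrite cards1.
pose c j := desc s j (k.+1 - j).
pose U := [set p.2 * c (nat_of_ord p.1) | p : 'I_k.+2 * gT in setX [set: 'I_k.+2] (braid_gen s k)].
have UP g j : g \in braid_gen s k -> j <= k.+1 -> g * c j \in U.
  move=> gG jk; apply/imsetP; exists (Ordinal (jk : j < k.+2), g) => //.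
  by rewrite !inE.
have Us i : i < k.+1 -> forall u, u \in U -> u * s i \in U.
  move=> ik _ /imsetP[[j g] /[!inE] /= gG ->]; have jk := ltn_ord j; rewrite -mulgA.
  have [ij|ji|ij] := ltngtP i.+1 j.
  - rewrite /c (coset_lt sb) // mulgA; apply: UP => //.
    by rewrite groupM // mem_braid_gen //; lia.
  - have [E|N] := eqVneq i j.
      rewrite -E /c (subSn (_ : i <= k)) // desc_recl -!mulgA s2 // mulg1.
      by rewrite -[k - i]/(k.+1 - i.+1); apply: UP.
    case: i ik ji N => [|i] ik ji N; first by lia.
    rewrite /c (coset_gt sb) ?mulgA //; try lia.
    by apply: UP => //; rewrite groupM // mem_braid_gen.
  - by rewrite -ij /c (@coset_pred _ k s i ik); apply: UP; rewrite // ltnW.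
pose St := [set g | [forall u in U, u * g \in U]].
have StP g : reflect (forall u, u \in U -> u * g \in U) (g \in St).
  by rewrite inE; apply: (iffP forall_inP).
have gSt : group_set St.
  apply/group_setP; split=> [|x y /StP Sx /StP Sy]; apply/StP => u uU.
    by rewrite mulg1.
  by rewrite mulgA; apply/Sy/Sx.
have sub : braid_gen s k.+1 \subset Group gSt.
  by apply: braid_gen_sub => i ik; apply/StP; apply: Us.
have U1 : 1 \in U.
  by have := UP 1 k.+1 (group1 _) (leqnn _); rewrite /c subnn mulg1.
have subU : braid_gen s k.+1 \subset U.
  by apply/subsetP=> g /(subsetP sub) /StP /(_ 1 U1); rewrite mul1g.
apply: leq_trans (subset_leq_card subU) _; apply: leq_trans (leq_imset_card _ _) _.
rewrite cardsX cardsT card_ord factS leq_mul2l /=.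
by apply: IHk => [|i ik]; [apply: braid_seq_le sb | apply: s2; apply: ltnW].
Qed.

End Coxeter.

Lemma braid_gen_adj_tperm k : braid_gen (tot (@adj_tperm k.+1)) k = [set: 'S_k.+1].
Proof.
apply/eqP; rewrite eqEsubset subsetT /= -(gen_tperm (ord0 : 'I_k.+1)) gen_subG.
apply/subsetP=> _ /imsetP[[y yk] _ ->].
elim: y yk => [|y IHy] yk.
  by rewrite (_ : Ordinal yk = ord0) ?tperm1 ?group1 //; apply: val_inj.
have yk' := ltnW yk; have ty := mem_braid_gen (tot (@adj_tperm k.+1)) (yk : y < k).
rewrite totEP /adj_tperm in ty.
set lo := Ordinal (strand_lo _) in ty; set hi := Ordinal (strand_hi _) in ty.
have -> : Ordinal yk = hi by apply: val_inj.
have [y0|y0] := eqVneq y 0%N.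
  by have -> : ord0 = lo by apply: val_inj; rewrite /= y0.
have := groupJ (IHy yk') ty.
have -> : Ordinal yk' = lo by apply: val_inj.
by rewrite tpermJ tpermL tpermD // -val_eqE /= ?(negbTE y0).
Qed.

Lemma perm_cent_trivial (T : finType) (x : {perm T}) : 2 < #|T| ->
  (forall y, commute x y) -> x = 1.
Proof.
move=> T2 cx; apply/permP=> a; rewrite perm1; apply/eqP/negPn/negP => xa.
have /card_gt0P[b] : 0 < #|~: [set a; x a]|.
  by rewrite cardsCs setCK cards2 eq_sym xa subn_gt0.
rewrite !inE negb_or => /andP[ba bx].
have := tpermJ a b x; have /commgP/conjg_fixP -> := commute_sym (cx (tperm a b)).
move/(congr1 (fun p : {perm T} => p a)); rewrite tpermL.
case: tpermP => [E|_ E|_ _ E]; first by rewrite -E eqxx in xa.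
  by rewrite E eqxx in bx.
by rewrite E eqxx in ba.
Qed.

Section CoxeterFaithful.
Variables (gT : finGroupType) (k : nat) (s : nat -> gT).
Hypotheses (k3 : 3 < k) (sb : braid_seq k s) (s01 : s 0 != s 1).
Hypothesis s2 : forall i, i < k -> s i * s i = 1.
Local Notation t := (tot (@adj_tperm k.+1)).
Local Notation D := (braid_gen (fun i => (s i, t i)) k).

Lemma adj_tperm_braid : braid_seq k t.
Proof. exact: (@braid_seq_word Cplane k.+1 _ _ (@adj_tperm_rel Cplane k.+1)). Qed.

Lemma coxeter_graph_card : #|D| <= k.+1`!.
Proof.
have [[far adj] [far' adj']] := (sb, adj_tperm_braid).
apply: coxeter_card => [|i ik].
  split=> [i j ij|i ik]; first by congr pair; [apply: far|apply: far'].
  by congr pair; [apply: adj|apply: adj'].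
by congr pair; [apply: s2|rewrite totEP; apply: adj_tpermK].
Qed.

Lemma coxeter_graph_snd : [set: 'S_k.+1] \subset [set d.2 | d in D].
Proof.
have -> : [set d.2 | d in D] = snd @* D by rewrite morphimEsub // subsetT.
rewrite -braid_gen_adj_tperm; apply: braid_gen_sub => i ik.
have := mem_morphim (snd_morphism gT 'S_k.+1) (in_setT _) (mem_braid_gen (fun i => (s i, t i)) ik).
by [].
Qed.

Lemma coxeter_graph_inj : {in D &, injective snd}.
Proof.
apply/imset_injP; rewrite eqn_leq leq_imset_card /=.
apply: leq_trans coxeter_graph_card _.
by have /subset_leq_card := coxeter_graph_snd; rewrite (card_Sym 'I_k.+1) card_ord.
Qed.

(* The graph [D] of the correspondence [s i <-> t i] projects bijectively onto
   the symmetric group, and the kernel of the other projection is normal. *)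
Lemma coxeter_faithful d : d \in D -> (d.1 == 1) = (d.2 == 1).
Proof.
move=> dD; apply/eqP/eqP => [d1|d2]; last first.
  by have -> : d = 1 by apply: coxeter_graph_inj; rewrite ?group1.
pose K := [set p | (1, p) \in D].
have gK : group_set K.
  apply/group_setP; split=> [|x y]; rewrite !inE ?group1 // => xK yK.
  by have := groupM xK yK; rewrite /= -[(1, x) * _]/(1 * 1, x * y) mulg1.
have KJ x y : x \in K -> x ^ y \in K.
  rewrite !inE => xK; have /subsetP/(_ y (in_setT _))/imsetP[[g y'] yD /= ->] := coxeter_graph_snd.
  by have := groupJ xK yD; rewrite -[(1, x) ^ _]/(1 ^ g, x ^ y') conj1g.
pose A := 'Alt_('I_k.+1); pose KA := (Group gK :&: A)%G.
have nKA : KA <| A.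
  apply/andP; split; first exact: subsetIr.
  apply/normsP=> y yA; apply/eqP; rewrite eqEcard cardJg leqnn andbT.
  apply/subsetP=> _ /imsetP[x /setIP[xK xA] ->]; rewrite inE KJ //=.
  by rewrite groupJ.
have [KA1|KAA] : KA = 1%G \/ KA = A :> {group _}.
  have /simpleP[_] : simple A by apply: simple_Alt5; rewrite card_ord.
  by move/(_ KA nKA) => [E|E]; [left|right]; apply/val_inj.
(* Commutators with [d.2] are even and lie in the normal subgroup [K], hence are trivial, so [d.2]
   is central in the symmetric group. *)
- have dK : d.2 \in K by rewrite inE -d1 -surjective_pairing.
  apply: perm_cent_trivial => [|y]; first by rewrite card_ord; lia.
  apply/commgP; rewrite -in_set1 -[[set 1]]/(1%G : {set _}) -KA1 inE /=; apply/andP; split.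
    by rewrite commgEl; have := groupM (groupVr (G := Group gK) dK) (KJ _ y dK).
  by rewrite Alt_even commgEl conjgE !odd_permM !odd_permV; case: odd_perm; case: odd_perm.
(* If [K] contains the alternating group, this even permutation is related both to 1 and to
   [s 0 * (s 1)^-1], against [s01]. *)
have : t 0 * (t 1)^-1 \in K.
  suff : t 0 * (t 1)^-1 \in KA by case/setIP.
  have odd_t i : i < k -> odd_perm (t i).
    by move=> ik; rewrite totEP odd_tperm -val_eqE /= neq_ltn ltnSn.
  by rewrite KAA Alt_even odd_permM odd_permV !odd_t //; lia.
rewrite inE => tK.
have : (s 0 * (s 1)^-1, t 0 * (t 1)^-1) \in D.
  have i0 : 0 < k by lia.
  have i1 : 1 < k by lia.
  by have := groupM (mem_braid_gen (fun i => (s i, t i)) i0)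
    (groupVr (mem_braid_gen (fun i => (s i, t i)) i1)).
move/coxeter_graph_inj => /(_ _ tK erefl) [] /divg1_eq E.
by move: s01; rewrite E eqxx.
Qed.

Lemma coxeter_card_ge : k.+1`! <= #|braid_gen s k|.
Proof.
have inj1 : {in D &, injective fst}.
  move=> d e dD eD de.
  have : d * e^-1 \in D by rewrite groupM ?groupV.
  move/coxeter_faithful; rewrite /= de mulgV eqxx => /esym/eqP/divg1_eq E.
  exact: coxeter_graph_inj.
have /subset_leq_card := coxeter_graph_snd.
rewrite (card_Sym 'I_k.+1) card_ord => H; apply: leq_trans H _.
apply: leq_trans (leq_imset_card _ _) _; rewrite -(card_in_imset inj1).
apply/subset_leq_card.
have -> : [set d.1 | d in D] = fst @* D by rewrite morphimEsub // subsetT.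
rewrite morphim_gen ?subsetT // gen_subG; apply/subsetP=> _ /morphimP[d _ /imsetP[i _ ->] ->] /=.
exact: mem_braid_gen.
Qed.

End CoxeterFaithful.

Lemma braid_gen2_card (gT : finGroupType) (s : nat -> gT) :
  braid_seq 2 s -> s 0 != s 1%N -> (6 <= #|braid_gen s 2|)%N.
Proof.
move=> sb s01; set G := braid_gen_group s 2.
have s0 : s 0 \in G by apply: mem_braid_gen.
have s1 : s 1%N \in G by apply: mem_braid_gen.
have nc : ~ commute (s 0) (s 1%N) by apply: (braid_ncomm sb s01).
have n01 : s 0 != s 0 ^ s 1%N.
  by apply/eqP=> E; apply/nc/commgP/conjg_fixP.
have n11 : s 1%N != s 0 ^ s 1%N.
  apply: contra s01 => /eqP E; rewrite -(inj_eq (@conjg_inj _ (s 1%N))) -E.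
  by rewrite conjgE mulKg.
have c3 : (3 <= #|s 0 ^: G|)%N.
  have <- : #|[set s 0; s 1%N; s 0 ^ s 1%N]| = 3.
    by rewrite setUC cardsU1 cards2 !inE s01 !(eq_sym (_ ^ _)) (negbTE n01) (negbTE n11).
  apply/subset_leq_card/subsetP=> x; rewrite !inE -orbA => /or3P[] /eqP->.
  - exact: class_refl.
  - by apply: (braid_class sb (d := 2)) => // i ik; apply: mem_braid_gen.
  - exact: memJ_class.
have c2 : (2 <= #|'C_G[s 0]|)%N.
  have <- : #|[set 1; s 0]| = 2.
    rewrite cards2; case: eqP => // E; exfalso; apply: nc; rewrite -E; exact/commute_sym/commute1.
  apply/subset_leq_card/subsetP=> x; rewrite in_set2 => /orP[] /eqP->; first exact: group1.
  by apply/setIP; split=> //; apply/cent1P.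
by rewrite -(Lagrange (subcent1_sub (s 0) G)) index_cent1 (leq_mul c2 c3).
Qed.

(** * Small images are generated by involutions *)

Section Involution.
Variables (gT : finGroupType) (k : nat) (s : nat -> gT).
Hypotheses (k3 : 3 < k) (sb : braid_seq k s) (s01 : s 0 != s 1).
Local Notation G := (braid_gen_group s k).
Hypothesis small : #|braid_gen s k| <= k.+1`!.

Definition tail_cent := <<s 0 |: [set s (nat_of_ord i).+2 | i : 'I_k.-2]>>.
Local Notation J := [group of tail_cent].

Lemma tail_s0 : s 0 \in J. Proof. by rewrite mem_gen // setU11. Qed.

Lemma tail_sS i : i.+2 < k -> s i.+2 \in J.
Proof.
move=> ik; have ik2 : i < k.-2 by lia.
by rewrite mem_gen //; apply/setU1P; right; apply/imsetP; exists (Ordinal ik2).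
Qed.

Lemma tail_sub : J \subset 'C_G[s 0].
Proof.
rewrite gen_subG; apply/subsetP=> x /setU1P[->|/imsetP[i _ ->]].
  by rewrite inE mem_braid_gen ?(ltnW (ltnW (ltnW k3))) //; apply/cent1P.
have ik := ltn_ord i; rewrite inE mem_braid_gen /=; last by lia.
by apply/cent1P/(braid_comm sb); lia.
Qed.

Lemma tail_card : ('C(k.+1, 2) * #|J| <= k.+1`!)%N.
Proof.
apply: leq_trans small; rewrite -(Lagrange (subcent1_sub (s 0) G)) index_cent1 mulnC.
apply: leq_mul; first exact/subset_leq_card/tail_sub.
apply: (braid_class_card sb) => //; first by lia.
by move=> i ik; apply: mem_braid_gen.
Qed.

Lemma tail_center : s 0 \in 'Z(J).
Proof.
apply/centerP; split; first exact: tail_s0.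
by move=> y /(subsetP tail_sub) /setIP[_ /cent1P].
Qed.

Lemma order_le2 : (#[s 0] <= 2)%N -> s 0 * s 0 = 1.
Proof.
move=> o2; have o1 : (#[s 0]%N > 1)%N.
  rewrite order_gt1; apply: contra s01 => /eqP E; apply/eqP.
  by apply: (braid_commute_eq sb); [lia | rewrite E; apply/commute_sym/commute1].
by have := expg_order (s 0); rewrite (_ : #[s 0] = 2%N) //; apply/eqP; rewrite eqn_leq o2.
Qed.

Lemma invol_step :
  (forall (hT : finGroupType) (u : nat -> hT), braid_seq k.-2 u -> u 0 != u 1%N ->
     (k.-1`! <= #|braid_gen u k.-2|)%N) -> s 0 * s 0 = 1.
Proof.
move=> IH; apply: order_le2.
pose Z := 'Z(J); pose u i := coset Z (s i.+2).
have JN : J \subset 'N(Z) by apply: normal_norm; apply: center_normal.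
have sN i : i.+2 < k -> s i.+2 \in 'N(Z) by move=> ik; apply/(subsetP JN)/tail_sS.
have ub : braid_seq k.-2 u.
  split=> [i j ij|i ik]; rewrite /u /commute -!morphM ?groupM ?sN //; try lia.
    by congr coset; apply: (braid_comm sb); lia.
  by congr coset; apply: sb.2; lia.
(* Otherwise [s 2 * (s 3)^-1] would be central in [J], and [s 2] would commute with [s 3]. *)
have u01 : u 0 != u 1%N.
  apply/eqP=> E; have {}E : coset Z (s 2) = coset Z (s 3) := E; have : coset Z (s 2 * (s 3)^-1) = 1.
    rewrite morphM ?morphV ?groupV ?sN //=; last by lia.
    by rewrite E mulgV.
  move/coset_idr => /(_ _) H; have {H} : s 2 * (s 3)^-1 \in Z.
    by apply: H; rewrite groupM ?groupV ?sN //; lia.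
  move/centerP=> [_ /(_ (s 3) (tail_sS k3))] c.
  apply: (@braid_ncomm _ _ _ sb s01 2 k3).
  by move: c; rewrite /commute mulgVK !mulgA => /(congr1 (mulg^~ (s 3))); rewrite mulgVK.
have := IH _ u ub u01.
have sub : braid_gen u k.-2 \subset J / Z.
  apply: braid_gen_sub => i ik; apply: mem_quotient; apply: tail_sS; lia.
move/leq_trans/(_ (subset_leq_card sub)); rewrite card_quotient // => H.
have oZ : (#[s 0] <= #|Z|)%N by rewrite subset_leq_card // cycle_subG tail_center.
have := tail_card; rewrite -(Lagrange (center_sub J)) => E.
(* So [J] has order at most 2(k-1)!, and its quotient by [Z] has order at least (k-1)!, which leaves
   at most 2 for [Z]. *)
have kE : k.+1`! = ('C(k.+1, 2) * (2 * k.-1`!))%N.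
  have k1 : (1 < k.+1)%N by lia.
  by rewrite -(bin_fact k1) subSS subn1.
rewrite kE leq_pmul2l in E; last by rewrite bin_gt0; lia.
have f0 := fact_gt0 k.-1.
rewrite -(leq_pmul2r f0); apply: leq_trans E; exact: leq_mul.
Qed.

(** The conjugating word crosses one pair of strands over another, which carries the half twist of
    one pair to that of the other. *)
Lemma braid_swap (H : groupType) (a b c : H) : a * b * a = b * a * b ->
  c * b * c = b * c * b -> commute a c -> a ^ (b * a * c * b) = c.
Proof.
move=> ab cb ac; apply: (@mulgI _ (b * a * c * b)); rewrite -conjgC.
rewrite !mulgA ab -(mulgA _ b c) -(mulgA _ (b * c)) -cb.
by rewrite !mulgA.
Qed.

Lemma small_index z i r : (z * i <= 8)%N -> (1 < i)%N -> (2 < r)%N ->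
  r %| z -> (0 < z)%N -> [/\ i = 2, r = z & (z <= 4)%N].
Proof.
move=> zi i1 r2 rz z0; have rlz := dvdn_leq z0 rz.
have z4 : (z <= 4)%N.
  by rewrite -(leq_pmul2r (isT : 0 < 2)); apply: leq_trans zi; rewrite leq_mul2l i1 orbT.
have i3 : (i < 3)%N.
  rewrite -(ltn_pmul2l (isT : 0 < 3)); apply: leq_ltn_trans (_ : z * i < 9)%N; last by [].
  by rewrite leq_mul2r (leq_trans r2 rlz) orbT.
split=> //; first by lia.
case/dvdnP: rz z0 z4 {zi rlz} => [[|[|q]] ->]; rewrite ?mul1n // !mulSn; lia.
Qed.

Lemma half_period e r : (2 < r <= 4)%N -> ~~ (r %| e) -> r %| e * 2 -> e %% r = 2.
Proof. by case/andP; case: r => [|[|[|[|[|r]]]]] //; lia. Qed.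

(* On six strands the quotient of [J] by its centre is an image of the braid
   group on four strands, which may be as small as the symmetric group of
   degree 3; the centralizer of [s 2] in [J] is bounded instead. *)
Lemma invol_step6 : k = 5 -> s 0 * s 0 = 1.
Proof.
move=> k5; apply: order_le2.
have sk i : i < 5 -> i < k by rewrite k5.
have scomm i j : i < 5 -> j < 5 -> i.+1 < j -> commute (s i) (s j).
  by move=> i5 j5 ij; apply: sb.1; rewrite ij sk.
have sadj i : i.+1 < 5 -> s i * s i.+1 * s i = s i.+1 * s i * s i.+1.
  by move=> i5; apply: sb.2; apply: sk.
have snc i : i.+1 < 5 -> ~ commute (s i) (s i.+1).
  by move=> i5; apply: (braid_ncomm sb s01); apply: sk.
rewrite leqNgt; apply/negP => r2.
pose Z := 'Z(J); pose M := 'C_J[s 2].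
have J2 : s 2 \in J by apply: (@tail_sS 0); apply: sk.
have J3 : s 3 \in J by apply: (@tail_sS 1%N); apply: sk.
have J4 : s 4 \in J by apply: (@tail_sS 2); apply: sk.
have Zc x y : x \in Z -> y \in J -> commute x y by case/centerP=> _; apply.
(* The order of [J] is at most 720 / 15 = 48, and the class of [s 2] in [J] has at least 6
   elements. *)
have M8 : (#|M| <= 8)%N.
  have J48 : (#|J| <= 48)%N.
    have := tail_card; move: #|J| => m; rewrite k5.
    by rewrite -[X in (_ <= X)%N]/(15 * 48)%N -['C(_, _)]/15 leq_pmul2l.
  have : (6 <= #|s 2 ^: J|)%N.
    apply: (@braid_class_card _ s k [group of J] 2 3 sb s01 k3) => //; first by rewrite k5.
    case=> [|[|i]] // /andP[_ i5]; apply: tail_sS; rewrite k5; exact: i5.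
  rewrite -index_cent1 => C6; rewrite -(leq_pmul2r (m := 6)) //.
  by apply: leq_trans J48; rewrite -(Lagrange (subcent1_sub (s 2) J)) leq_mul2l C6 orbT.
have ZM : Z \subset M.
  apply/subsetP=> x xZ; apply/setIP; split; first by case/centerP: xZ.
  by apply/cent1P; apply: Zc.
have s2Z : s 2 \notin Z by apply/negP => /Zc /(_ J3); apply: (snc 2).
have s4Z : s 4 \notin Z by apply/negP => /Zc /(_ J3) /commute_sym; apply: (snc 3).
have oZ : #[s 0] %| #|Z| by rewrite order_dvdG // tail_center.
have s2M : s 2 \in M by apply/setIP; split=> //; apply/cent1P.
have s4M : s 4 \in M by apply/setIP; split=> //; apply/cent1P/commute_sym/scomm.
have LM : (#|Z| * #|M : Z|)%N = #|M| by apply: Lagrange.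
have iMZ : #|M : Z| != 1%N.
  by rewrite indexg_eq1; apply: contra s2Z => /subsetP; apply.
have [i2 oE Z4] : [/\ #|M : Z| = 2, #[s 0] = #|Z| & (#|Z| <= 4)%N].
  apply: small_index; rewrite ?LM ?cardG_gt0 //.
  by rewrite ltn_neqAle eq_sym iMZ indexg_gt0.
have ZE : <[s 0]> = Z.
  by apply/eqP; rewrite eqEcard cycle_subG tail_center -oE leqnn.
(* Both [s 2] and [s 4] lie in [M] outside its subgroup [Z] of index 2, hence in the same coset. *)
have w_in : (s 2)^-1 * s 4 \in <[s 0]>.
  have E : s 2 *: Z = M :\: Z.
    apply/eqP; rewrite eqEcard card_lcoset cardsD (setIidPr ZM).
    rewrite -LM i2 muln2 -addnn addnK leqnn andbT.
    apply/subsetP=> _ /lcosetP[z zZ ->]; rewrite inE groupMr // s2Z /= groupM //.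
    exact: (subsetP ZM).
  by rewrite ZE -mem_lcoset E inE s4Z.
have [e we] := cycleP _ _ w_in.
(* This conjugation exchanges [s 2] and [s 4], so it inverts [(s 2)^-1 * s 4]; it also fixes that
   element, a power of [s 0]. Hence the element squares to 1. *)
have sw1 : s 2 ^ (s 3 * s 2 * s 4 * s 3) = s 4.
  by apply: braid_swap; [apply: sadj | symmetry; apply: sadj | apply: scomm].
have sw2 : s 4 ^ (s 3 * s 2 * s 4 * s 3) = s 2.
  have -> : s 3 * s 2 * s 4 * s 3 = s 3 * s 4 * s 2 * s 3.
    by rewrite -!mulgA (mulgA (s 2)) (scomm 2 4) // !mulgA.
  by apply: braid_swap; [symmetry; apply: sadj | apply: sadj | apply/commute_sym/scomm].
have sw3 : s 0 ^ (s 1 * s 0 * s 2 * s 1) = s 2.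
  by apply: braid_swap; [apply: sadj | symmetry; apply: sadj | apply: scomm].
have fix0 : s 0 ^ (s 3 * s 2 * s 4 * s 3) = s 0.
  by apply/conjg_fixP/commgP; do 3?apply: commuteM; apply: scomm.
have fix4 : s 4 ^ (s 1 * s 0 * s 2 * s 1) = s 4.
  by apply/conjg_fixP/commgP; do 3?apply: commuteM; apply/commute_sym/scomm.
have w2 : s 0 ^+ (e * 2) = 1.
  have : (s 0 ^+ e) ^ (s 3 * s 2 * s 4 * s 3) = s 0 ^+ e by rewrite conjXg fix0.
  rewrite -{1}we conjMg conjVg sw1 sw2 => E.
  by rewrite expgM expg2 -{1}we -E !mulgA mulgK mulVg.
have w1 : s 0 ^+ e != 1.
  rewrite -we; apply/eqP => /(congr1 (mulg (s 2))); rewrite mulVKg mulg1 => E.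
  by apply: (snc 1%N) => //; rewrite -E; apply: scomm.
have sw4 : s 2 ^ (s 1 * s 0 * s 2 * s 1) = s 0.
  have -> : s 1 * s 0 * s 2 * s 1 = s 1 * s 2 * s 0 * s 1.
    by rewrite -!mulgA (mulgA (s 0)) (scomm 0 2) // !mulgA.
  by apply: braid_swap; [symmetry; apply: sadj | apply: sadj | apply/commute_sym/scomm].
(* A cyclic group of order 3 or 4 has an involution only in order 4, where it is the square of a
   generator. *)
have e2 : e %% #[s 0] = 2.
  by apply: half_period; rewrite ?r2 ?oE // -oE order_dvdn // w2.
have {}we : (s 2)^-1 * s 4 = s 0 ^+ 2 by rewrite we -expg_mod_order e2.
(* Exchanging [s 0] and [s 2] while fixing [s 4] gives a second equation; the two force [s 0 = s 2],
   although [s 3] commutes with only one of them. *)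
have we' : (s 0)^-1 * s 4 = s 2 ^+ 2.
  by have := congr1 (conjg^~ (s 1 * s 0 * s 2 * s 1)) we; rewrite conjMg conjVg conjXg sw3 sw4 fix4.
have : s 2 * s 0 ^+ 2 = s 0 * s 2 ^+ 2 by rewrite -we -we' !mulVKg.
rewrite !expg2 !mulgA -(scomm 0 2) // -!mulgA => /mulgI /mulgI E.
by apply: (snc 2) => //; rewrite -E; apply: scomm.
Qed.

End Involution.

Lemma braid_invol_all (gT : finGroupType) k (s : nat -> gT) :
  3 < k -> braid_seq k s -> s 0 * s 0 = 1 -> forall i, i < k -> s i * s i = 1.
Proof.
move=> k3 sb s00 i ik.
have /imsetP[g _ ->] : s i \in s 0 ^: braid_gen_group s k.
  by apply: (braid_class sb (d := k)) => // j jk; apply: mem_braid_gen.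
by rewrite -conjMg s00 conj1g.
Qed.

Lemma braid_image_card k : k = 2 \/ 3 < k ->
  forall (gT : finGroupType) (s : nat -> gT), braid_seq k s -> s 0 != s 1%N ->
  (k.+1`! <= #|braid_gen s k|)%N.
Proof.
elim/ltn_ind: k => k IHk [->|k3] gT s sb s01; first exact: braid_gen2_card.
(* A smaller image satisfies the size hypothesis of the involution steps; its generators then square
   to 1, and [coxeter_card_ge] contradicts its size. *)
rewrite leqNgt; apply/negP => /[dup] lt; rewrite ltnNge => /negP; apply.
apply: coxeter_card_ge => //; apply: braid_invol_all => //.
have [k5|k5] := eqVneq k 5; first exact: invol_step6 (ltnW lt) k5.
apply: (invol_step k3 sb s01 (ltnW lt)) => hT u ub u01.
have -> : k.-1 = k.-2.+1 by lia.
by apply: IHk => //; lia.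
Qed.

(* The lower bound for the image of the subsequence that commutes with [s 0]
   leaves no room for an order greater than 2. *)
Lemma braid_invol (gT : finGroupType) k (s : nat -> gT) :
  3 < k -> braid_seq k s -> s 0 != s 1%N -> (#|braid_gen s k| <= k.+1`!)%N ->
  forall i, i < k -> s i * s i = 1.
Proof.
move=> k3 sb s01 small; apply: braid_invol_all => //.
have [k5|k5] := eqVneq k 5; first exact: invol_step6 small k5.
apply: (invol_step k3 sb s01 small) => hT u ub u01.
have -> : k.-1 = k.-2.+1 by lia.
by apply: braid_image_card => //; lia.
Qed.

(** * Endomorphisms of braid groups *)

Lemma comm_subgroup (G : groupType) (N : G -> Prop) (b : G) :
  is_subgroup N -> (forall x z, N x -> N (x ^ z)) ->
  is_subgroup (fun a => N [~ a, b]).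
Proof.
case=> N1 NM NV NJ; split=> [|x y Nx Ny|x Nx]; first by rewrite comm1g.
- have -> : [~ x * y, b] = [~ x, b] ^ y * [~ y, b].
    by rewrite !commgEl !conjgE invgM !mulgA mulgK !mulgK.
  by apply: NM => //; apply: NJ.
- have -> : [~ x^-1, b] = ([~ x, b]^-1) ^ x^-1.
    by rewrite invgR !commgEl !conjgE !invgK !mulgA mulgK.
  by apply/NJ/NV.
Qed.

(** * Perfectness of the commutator subgroup *)

Section DerivedPerfect.
Variables (X : surface) (k : nat).
Hypothesis k3 : 3 < k.
Local Notation B := (braid_group X k.+1).
Local Notation s := (sg X k.+1).
Local Notation B1 := (derived (fun _ : B => True)).
Local Notation B2 := (derived B1).

Let sb : braid_seq k s := sg_braid X k.+1.

Lemma sg_ind (Q : B -> Prop) : is_subgroup Q -> (forall i, i < k -> Q (s i)) ->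
  forall b, Q b.
Proof.
move=> sQ Qs; apply: pres_subgroup => // i; have := Qs i (ltn_ord i).
by rewrite /sg totE.
Qed.

Lemma sg_conj i : i.+1 < k -> s i ^ (s i * s i.+1)^-1 = s i.+1.
Proof.
move=> ik; rewrite conjgE invgK mulgA sb.2 // -!mulgA; apply: (@mulgI _ (s i.+1)^-1).
by rewrite mulKg mulVg mulgA mulgV.
Qed.

Lemma sg_B1 i : i < k -> B1 ((s 0)^-1 * s i).
Proof.
have [P1 PM _] := derived_subgroup (fun _ : B => True).
elim: i => [|i IHi] ik; first by rewrite mulVg.
have -> : (s 0)^-1 * s i.+1 = (s 0)^-1 * s i * [~ s i, (s i * s i.+1)^-1].
  by rewrite commgEl sg_conj // -mulgA mulVKg.
by apply: PM; [apply: IHi; apply: ltnW | apply: derived_comm].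
Qed.

Lemma sg_B2 i : i.+1 < k -> B2 ((s i)^-1 * s i.+1).
Proof.
have [P1 PM PV] := derived_subgroup (fun _ : B => True).
have NJ : forall x z, B2 x -> B2 (x ^ z).
  by apply: derived_normal => x z; apply: derived_normal.
elim: i => [|i IHi] ik; last first.
  (* Conjugation by the product of all generators shifts their indices by one. *)
  have := NJ _ (asc s 0 k)^-1 (IHi (ltnW ik)).
  have C j : j.+1 < k -> s j ^ (asc s 0 k)^-1 = s j.+1.
    by move=> jk; rewrite conjgE invgK mulgA -(asc_conj sb) // mulgK.
  by rewrite conjMg conjVg !C // ltnW.
have c3 j : (j < 2)%N -> commute (s 3) (s j) by move=> j2; apply: (braid_comm sb); lia.
have Jc (x y : B) : commute x y -> x ^ y = x by move=> c; apply/conjg_fixP/commgP.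
(* Conjugation by [g] takes [s 0] to [s 1] and fixes [s 3], so [[~ h, g]] is [(s 0)^-1 * s 1]. The
   factors [s 3] bring the exponent sums to zero, which places [g] and [h] in [B1]. *)
pose g := (s 0 * s 1)^-1 * s 3 * s 3; pose h := s 0 * (s 3)^-1.
have Bh : B1 h.
  have -> : h = ((s 0)^-1 * s 3)^-1.
    by rewrite /h invgM invgK; apply/commute_sym/commute_sym/commuteV/commute_sym/c3.
  by apply: PV; apply: sg_B1.
have Bg : B1 g.
  have -> : g = ((s 0)^-1 * s 1)^-1 * ((s 0)^-1 * s 3) * ((s 0)^-1 * s 3).
    have c0 : commute (s 3) (s 0)^-1 by apply/commuteV/c3.
    by rewrite /g !invgM invgK -!mulgA mulVKg; congr (_ * _); rewrite [RHS]mulgA c0 -mulgA.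
  have B13 : B1 ((s 0)^-1 * s 3) by apply: sg_B1.
  have B11 : B1 ((s 0)^-1 * s 1) by apply: sg_B1; lia.
  exact: (PM _ _ (PM _ _ (PV _ B11) B13) B13).
have -> : (s 0)^-1 * s 1 = [~ h, g].
  rewrite commgEl /h conjMg conjVg.
  have -> : s 0 ^ g = s 1.
    by rewrite /g -mulgA conjgM sg_conj ?(ltn_trans _ k3) // (Jc (s 1)) //;
      apply: commuteM; apply/commute_sym/c3.
  have -> : s 3 ^ g = s 3.
    apply: Jc; apply: commuteM; [apply: commuteM|] => //.
    by apply: commuteV; apply: commuteM; apply: c3.
  have c01 : commute (s 3) ((s 0)^-1 * s 1).
    by apply: commuteM; [apply/commuteV/c3 | apply: c3].
  by rewrite invgM invgK !mulgA -(mulgA (s 3)) c01 mulgK.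
exact: derived_comm.
Qed.

(** Modulo [B2] all generators coincide by [sg_B2], so the quotient by [B2] is abelian and [B1] is
    contained in [B2]. *)
Lemma derived_perfect : is_perfect B1.
Proof.
split=> [|Q sQ cQ x Bx]; first exact: derived_subgroup.
have NJ : forall x z, B2 x -> B2 (x ^ z).
  by apply: derived_normal => y z; apply: derived_normal.
have sN : is_subgroup B2 by apply: derived_subgroup.
have [N1 NM NV] := sN.
have N0 i : i < k -> B2 ((s 0)^-1 * s i).
  elim: i => [|i IHi] ik; first by rewrite mulVg.
  by rewrite -(mulVKg (s i) (s i.+1)) mulgA; apply: NM; [apply: IHi; apply: ltnW | apply: sg_B2].
have NR b q : B2 q -> B2 [~ q, b].
  by move=> Bq; rewrite commgEl; apply: NM; [apply: NV | apply: NJ].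
have Nij i j : i < k -> j < k -> B2 [~ s j, s i].
  move=> ik jk; have [_ CM _] := comm_subgroup (s i) sN NJ.
  rewrite -(mulVKg (s i) (s j)); apply: CM; first by rewrite commgg.
  apply: NR; have -> : (s i)^-1 * s j = ((s 0)^-1 * s i)^-1 * ((s 0)^-1 * s j).
    by rewrite invgM invgK -mulgA mulVKg.
  by apply: NM; [apply: NV|]; apply: N0.
have Nib i b : i < k -> B2 [~ b, s i].
  by move=> ik; move: b; apply: sg_ind => [|j jk]; [apply: comm_subgroup | apply: Nij].
have Nab a b : B2 [~ a, b].
  move: a; apply: sg_ind => [|j jk]; first exact: comm_subgroup.
  by rewrite -invgR; apply: NV; apply: Nib.
by apply: (Bx B2 sN (fun a b _ _ => Nab a b)).
Qed.

End DerivedPerfect.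

Lemma powers_subgroup (G : groupType) (h : G) :
  is_subgroup (fun x => exists m : nat, x = h ^+ m \/ x = h ^- m).
Proof.
have sub m l : exists j : nat, h ^+ m * h ^- l = h ^+ j \/ h ^+ m * h ^- l = h ^- j.
  have [lm|/ltnW ml] := leqP l m; [exists (m - l); left|exists (l - m); right].
    by rewrite expgnFr.
  by rewrite expgnFr // invgF.
have comm m l : commute (h ^- m) (h ^+ l).
  exact/commute_sym/commuteV/commuteX2/commute_refl.
split=> [|x y [m Em] [l El]|x [m [->|->]]]; first by exists 0; left.
- case: Em El => -> [] ->; [exists (m + l); left|exact: sub| |exists (l + m); right].
  + by rewrite expgnDr.
  + by rewrite comm.
  + by rewrite expgnDr invgM.
- by exists m; right.
- by exists m; left; rewrite invgK.
Qed.

Section Endomorphism.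
Variables (X : surface) (k : nat).
Local Notation B := (braid_group X k.+1).
Local Notation s := (sg X k.+1).
Variable phi : B -> B.
Hypotheses (k3 : 3 < k) (phiM : {morph phi : x y / x * y}).

Definition image_perm (b : B) : 'S_k.+1 := braid_perm (phi b).
Local Notation u := (tot (fun i : 'I_k => image_perm (sigma X (n := k.+1) i))).

Lemma image_permM : {morph image_perm : x y / x * y}.
Proof. by move=> x y; rewrite /image_perm phiM braid_permM. Qed.

Lemma image_perm_braid : braid_seq k u.
Proof.
apply: (@braid_seq_word X k.+1) => v w vw.
rewrite -!(pres_hom_word _ image_permM); congr image_perm.
exact: (pres_piP _ _ _).2 (pres_rel vw).
Qed.

Lemma sigma_ind (Q : B -> Prop) : is_subgroup Q ->
  (forall i, Q (sigma X (n := k.+1) i)) -> forall b, Q b.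
Proof. exact: pres_subgroup. Qed.

Lemma cyclic_image : u 0 = u 1 -> cyclic_hom phi.
Proof.
move=> E; have uE := braid_const image_perm_braid E.
have imc b : image_perm b \in <[u 0]>.
  move: b; apply: sigma_ind => [|i].
    split=> [|x y Hx Hy|x Hx]; rewrite ?(morphg1 image_permM) ?image_permM ?(morphgV image_permM).
    - exact: group1.
    - exact: groupM.
    - by rewrite groupV.
  by rewrite -(uE i (ltn_ord i)) totE cycle_id.
have pB1 := derived_perfect X k3.
have phi1 : forall x, derived (fun _ : B => True) x -> phi x = 1.
  have k1 : 1 < k.+1 by lia.
  apply: (no_perfect_image (f := phi) pB1 _ _ (@pure_no_perfect X k.+1 k1)) => [x y _ _|].
    exact: phiM.
  move=> x dx; apply: (dx (fun y => image_perm y = 1)) => [|a b _ _].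
    split=> [|y z Hy Hz|y Hy]; first exact: morphg1 image_permM.
      by rewrite image_permM Hy Hz mulg1.
    by rewrite (morphgV image_permM) Hy invg1.
  rewrite (morphgR image_permM); apply/eqP/commgP.
  exact: (centsP (cycle_abelian (u 0)) _ (imc a) _ (imc b)).
have phis i : i < k -> phi (s i) = phi (s 0).
  move=> ik; have := phi1 _ (sg_B1 (X := X) ik).
  by rewrite phiM (morphgV phiM) => /(congr1 (mulg (phi (s 0)))); rewrite mulVKg mulg1.
exists (phi (s 0)); apply/seteqP; split=> [_ [b _ <-]|x].
  move: b; apply: sigma_ind => [|i].
    have [P1 PM PV] := powers_subgroup (phi (s 0)).
    split=> [|x y Hx Hy|x Hx]; rewrite ?(morphg1 phiM) ?phiM ?(morphgV phiM).
    - exact: P1.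
    - exact: PM.
    - exact: PV.
  by exists 1%N; left; rewrite expg1 -(phis i) // /sg totE.
have phiX m : phi (s 0 ^+ m) = phi (s 0) ^+ m.
  by elim: m => [|m IHm]; rewrite ?(morphg1 phiM) // !expgS phiM IHm.
by move=> [m [->|->]]; [exists (s 0 ^+ m) | exists (s 0 ^- m)]; rewrite ?(morphgV phiM) ?phiX.
Qed.

Lemma image_perm_ker : u 0 != u 1 -> forall b, (image_perm b == 1) = (braid_perm b == 1).
Proof.
move=> u01 b; have ub := image_perm_braid.
have small : (#|braid_gen u k| <= k.+1`!)%N.
  apply: leq_trans (subset_leq_card (subsetT _)) _.
  by rewrite (card_Sym 'I_k.+1) card_ord.
have u2 := braid_invol k3 ub u01 small.
have := @coxeter_faithful _ _ _ k3 ub u01 u2 (image_perm b, braid_perm b); apply.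
move: b; apply: sigma_ind => [|i].
  split=> [|x y Hx Hy|x Hx].
  - by rewrite (morphg1 image_permM) (morphg1 (@braid_permM _ _)) group1.
  - by rewrite image_permM braid_permM; apply: (groupM Hx Hy).
  - by rewrite (morphgV image_permM) (morphgV (@braid_permM _ _)); have := groupVr Hx.
have := mem_braid_gen (fun i => (u i, tot (@adj_tperm k.+1) i)) (ltn_ord i).
by rewrite !totE braid_perm_sigma.
Qed.

End Endomorphism.

Local Open Scope classical_set_scope.

Theorem theorem2p2 (X : surface) (n : nat) (n_gt4 : 4 < n)
    (phi : {multiplicative braid_group X n -> braid_group X n})
    (phi_noncyclic : ~ cyclic_hom phi) :
  phi @` pure_braids X n `<=` pure_braids X n /\
  pure_braids X n = phi @^-1` pure_braids X n.
Proof.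
case: n n_gt4 phi phi_noncyclic => // k k3 phi ncyc.
have phiM : {morph phi : x y / x * y} by apply: gmulfM.
have ker := image_perm_ker k3 phiM.
have {}ker b : (image_perm phi b == 1) = (braid_perm b == 1).
  by apply: ker; apply/eqP => /(cyclic_image k3 phiM).
split=> [_ [b /eqP b1 <-]|]; first by apply/eqP; rewrite -[_ == _]/(image_perm phi b == 1) ker.
apply/seteqP; split=> b /eqP b1; apply/eqP; last by rewrite -ker.
by rewrite -[_ == _]/(image_perm phi b == 1) ker.
Qed.
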